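(* Let $u_h=(u_{h,0},u_{h,1},u_{h,2})\in W_h$ satisfy $A_h(u_h,v)=L_h(v)$ for all $v\in W_h$. For a macro element $M\in\mathcal M_{h,i}$, $i\in\{0,1,2\}$, define on $\partial M\cap\mathcal E_{h,i}$ the discrete normal flux $$\Sigma_n(u_{h,i})=\langle\nu_i\cdot A_i\nabla_iu_{h,i}\rangle-(h^{-1}\lambda_{a_i}+\lambda_{b_i})[u_{h,i}]-(\nu_i\cdot\beta_i)\langle u_{h,i}\rangle,$$ where on each face of $\partial M$ the two neighbouring elements are enumerated so that $T_1\subset M$ (so $\nu_i=\nu_{i,1}$ points out of $M$). Then the following local conservation laws hold. (1) For each macro element $M\in\mathcal M_{h,i}$ of a bulk macro mesh, $i\in\{1,2\}$, $$(\Sigma_n(u_{h,i}),1)_{\partial M\cap\Omega_i}+([\kappa u_h]_i,1)_{M\cap\Omega_0}+\tfrac12((\mathrm{div}_i\beta_i)u_{h,i},1)_{M\cap\Omega_i}+(f_i,1)_{M\cap\Omega_i}=0.$$ (2) For each macro element $M\in\mathcal M_{h,0}$ of the surface macro mesh, $$(\Sigma_n(u_{h,0}),1)_{\partial M\cap\Omega_0}-\sum_{i=1}^2([\kappa u_h]_i,1)_{M\cap\Omega_0}+\tfrac12((\mathrm{div}_0\beta_0)u_{h,0},1)_{M\cap\Omega_0}+(f_0,1)_{M\cap\Omega_0}=0.$$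
   Context: Geometry and data. $\Omega\subset\mathbb R^d$, $d\in\{2,3\}$, is a domain with convex polygonal boundary, partitioned into subdomains $\Omega_1,\Omega_2$ by a smooth closed $(d-1)$-dimensional interface $\Omega_0$; $\Omega_2$ is the part inside $\Omega_0$, so $\partial\Omega\subset\partial\Omega_1$, and $\Omega_0$ has a tubular neighborhood contained in $\Omega$ on which the closest point map is well defined. $d_1=d_2=d$, $d_0=d-1$. $n_i$ is the exterior unit normal to $\partial\Omega_i$ ($i=1,2$), $n_0$ (also written $n$ on $\Omega_0$) a unit normal to $\Omega_0$. $\nabla_i=\nabla$ for $i=1,2$; $\nabla_0=(I-n_0\otimes n_0)\nabla$ is the tangential gradient and $\nabla_n=n_0\cdot\nabla$. For $i=0,1,2$, $\beta_i$ is a smooth tangential vector field on $\Omega_i$ with $\mathrm{div}_i\beta_i=0$ (tangential divergence if $i=0$), and $n_i\cdot\beta_i=0$ on $\partial\Omega_i$ for $i=1,2$. $A_i:\Omega_i\to\mathbb R^{d\times d}$ are smooth matrix fields, uniformly positive definite on the tangent spaces of $\Omega_i$. $\kappa_i,\kappa_{0,i}>0$ ($i=1,2$) are constants, $[\kappa v]_i=\kappa_iv_i-\kappa_{0,i}v_0$, $\widetilde\kappa_0=1$, $\widetilde\kappa_i=\kappa_i/\kappa_{0,i}$ for $i=1,2$. $f_i$, $i=0,1,2$, are the given source terms on $\Omega_i$. $(\cdot,\cdot)_\omega$ is the $L^2$ inner product over $\omega$ (summed over the members if $\omega$ is a collection of sets). Mesh. $\mathcal T_h$ is a quasiuniform partition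 of $\Omega$ into shape regular simplices with mesh parameter $h$. $\mathcal T_{h,i}=\{T\in\mathcal T_h:T\cap\Omega_i\ne\emptyset\}$; $\mathcal F_{h,i}$ is the set of interior faces of $\mathcal T_{h,i}$; $\mathcal K_{h,i}=\{T\cap\Omega_i:T\in\mathcal T_{h,i}\}$, $\mathcal E_{h,i}=\{F\cap\Omega_i:F\in\mathcal F_{h,i}\}$. $V_h$ is the space of discontinuous piecewise linear ($P_1$) functions on $\mathcal T_h$ vanishing on $\partial\Omega$; $W_{h,i}=V_h|_{\mathcal T_{h,i}}$; $W_h=\bigoplus_{i=0}^2W_{h,i}$. For a face shared by $T_1,T_2\in\mathcal T_{h,i}$, $\nu_{i,j}$ is the exterior unit normal of $T_j$ (for $i=0$: the exterior unit co-normal of $T_j\cap\Omega_0$, tangent to $\Omega_0$ and normal to $\partial(T_j\cap\Omega_0)$), and $\nu_i=\nu_{i,1}$. $[v]=v_1-v_2$, $\langle v\rangle=\theta_{F,1}v_1+\theta_{F,2}v_2$ with $v_l=v|_{T_l}$, where $\theta_{F,j}\ge0$, $\theta_{F,1}+\theta_{F,2}=1$; for a vector field $v$, $\langle\nu_i\cdot v\rangle=\theta_{F,1}\nu_{i,1}\cdot v_1-\theta_{F,2}\nu_{i,2}\cdot v_2$. Macro elements. $T\in\mathcal T_{h,i}$, with diameter $h_T$, has a large intersection if $\gamma_i\le|T\cap\Omega_i|/h_T^{d_i}$, $\gamma_i>0$ a constant independent of $T$ and $h$. $\mathcal M_{h,i}$ is a macro element partition: each $T\in\mathcal T_{h,i}$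 belongs to exactly one set $\mathcal T_{h,i,M}$, $M=\bigcup_{T\in\mathcal T_{h,i,M}}T$, and in $\mathcal T_{h,i,M}$ there is one element $T_M$ with a large intersection to which all elements of $\mathcal T_{h,i,M}$ are connected via a uniformly bounded number of interior faces of $\mathcal T_{h,i,M}$. $\mathcal F_{h,i}(M)$ is the set of interior faces of $\mathcal T_{h,i,M}$. Stabilization. $s_{h,i}=\sum_{M\in\mathcal M_{h,i}}s_{h,i,M}$ with $s_{h,i,M}(v,w)=\sum_{k=0}^1\tau_{i,k}h^{2k-1}([\nabla^kv],[\nabla^kw])_{\mathcal F_{h,i}(M)}$ for $i=1,2$ and $s_{h,0,M}(v,w)=\sum_{k=0}^1\tau_{0,k}h^{2k-2}([\nabla^kv],[\nabla^kw])_{\mathcal F_{h,0}(M)}+\tau_{0,2}h^2(\nabla_nv,\nabla_nw)_{M\cap\Omega_0}$, $\tau_{i,k}>0$. Method. $A_h(v,w)=\sum_{i=0}^2\widetilde\kappa_i\big(a_{h,i}(v_i,w_i)+b_{h,i}(v_i,w_i)+s_{h,i}(v_i,w_i)\big)+\sum_{i=1}^2(\kappa_{0,i}^{-1}[\kappa v]_i,[\kappa w]_i)_{\Omega_0}$, $L_h(v)=\sum_{i=0}^2(f_i,\widetilde\kappa_iv_i)_{\Omega_i}$, with $a_{h,i}(v,w)=(A_i\nabla_iv,\nabla_iw)_{\mathcal K_{h,i}}-(\langle\nu_i\cdot A_i\nabla_iv\rangle,[w])_{\mathcal E_{h,i}}-([v],\langle\nu_i\cdot A_i\nabla_iw\rangle)_{\mathcal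 E_{h,i}}+(\lambda_{a_i}h^{-1}[v],[w])_{\mathcal E_{h,i}}$, $b_{h,i}(v,w)=\frac12\big((\beta_i\cdot\nabla_iv,w)_{\mathcal K_{h,i}}-(v,\beta_i\cdot\nabla_iw)_{\mathcal K_{h,i}}\big)+\frac12\big(((\nu_i\cdot\beta_i)\langle v\rangle,[w])_{\mathcal E_{h,i}}-((\nu_i\cdot\beta_i)[v],\langle w\rangle)_{\mathcal E_{h,i}}\big)+(\lambda_{b_i}[v],[w])_{\mathcal E_{h,i}}$, $\lambda_{a_i}=\tau_{a_i}\,\nu_i\cdot A_i\nu_i$, $\lambda_{b_i}=\tau_{b_i}|\nu_i\cdot\beta_i|$, $\tau_{a_i}>0$ (sufficiently large for coercivity), $\tau_{b_i}\ge0$.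
   Formalization: Signs of the [κu_h]_i terms are reversed in (1) and (2); the term ((θ_{F,1}−1/2)(ν_i·β_i)[u_{h,i}],1) on ∂M is added (zero for θ=1/2); M must have no element with a facet on ∂Ω; Gauss' theorem on the cut elements T∩Ω_i (general position of Ω_0) is assumed. *)

(* Defs.v *)
From HB Require Import structures.
From mathcomp Require Import all_boot all_order all_algebra.
From mathcomp Require Import all_classical all_reals all_analysis.

Set Implicit Arguments.
Unset Strict Implicit.
Unset Printing Implicit Defensive.

Import Order.TTheory GRing.Theory Num.Theory.
Import numFieldNormedType.Exports.

Local Open Scope classical_set_scope.
Local Open Scope ring_scope.

(* The topology of 'rV[R]_d in the library comes from the sup norm; lengths,
   diameters and normals below are Euclidean. *)
Section euclidean.
Context {R : realType} {d : nat}.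
Local Notation V := 'rV[R]_d.

Definition dot (x y : V) : R := \sum_(k < d) x 0 k * y 0 k.
Definition enorm (x : V) : R := Num.sqrt (dot x x).

Definition ediam (C : set V) : \bar R :=
  ereal_sup [set z | exists x y : V, [/\ C x, C y & z = (enorm (x - y))%:E]].

End euclidean.

Section hausdorff.
Context {R : realType} {d : nat}.
Local Notation V := 'rV[R]_d.
Local Open Scope ereal_scope.

(* Volume of the unit ball of R^k: 1, 2, pi, 4 pi / 3, ... *)
Fixpoint unit_ball_volume (k : nat) : R :=
  match k with
  | 0 => 1%R
  | 1 => 2%R
  | k'.+2 => (2 * pi / k%:R * unit_ball_volume k')%R
  end.

(* The normalization makes H^k agree with k-dimensional Lebesgue measure. *)
Definition hausdorff_weight (k : nat) (delta : R) (C : set V) : \bar R :=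
  if `[< C = set0 >] then 0
  else if ediam C <= delta%:E
  then (unit_ball_volume k / 2 ^+ k)%:E * ediam C ^+ k
  else +oo.

(* [mu_ext] over the sigma-algebra of all subsets: the infimum runs over all
   countable covers. *)
Definition hausdorff_pre (k : nat) (delta : R) (A : set V) : \bar R :=
  @mu_ext _ (g_sigma_algebraType [set: set V]) R (hausdorff_weight k delta) A.

Definition hausdorff_outer (k : nat) (A : set V) : \bar R :=
  ereal_sup [set hausdorff_pre k delta A | delta in [set e : R | (0 < e)%R]].

Lemma unit_ball_volume_ge0 k : (0 <= unit_ball_volume k)%R.
Proof.
suff: (0 <= unit_ball_volume k)%R /\ (0 <= unit_ball_volume k.+1)%R by case.
elim: k => [|k [h0 h1]]; first by split => //=; rewrite ler01.
split=> //; rewrite [unit_ball_volume k.+2]/=.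
by rewrite mulr_ge0 // divr_ge0 // mulr_ge0 // pi_ge0.
Qed.

Lemma hausdorff_weight0 k delta : hausdorff_weight k delta set0 = 0.
Proof. by rewrite /hausdorff_weight; case: asboolP. Qed.

Lemma hausdorff_weight_ge0 k delta (C : set V) : 0 <= hausdorff_weight k delta C.
Proof.
rewrite /hausdorff_weight; case: asboolP => // /eqP/set0P[x Cx].
case: ifP => // _; apply: mule_ge0.
  by rewrite lee_fin divr_ge0 ?unit_ball_volume_ge0 // exprn_ge0.
apply: expe_ge0; apply: le_trans (ereal_sup_ubound _).
- exact: (lexx 0).
- exists x, x; split => //; rewrite subrr /enorm (_ : dot 0 0 = 0%R) ?sqrtr0 //.
  by rewrite /dot big1 // => i _; rewrite mxE mul0r.
Qed.

Lemma hausdorff_outer0 k : hausdorff_outer k set0 = 0.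
Proof.
apply/eqP; rewrite eq_le; apply/andP; split.
  apply: ge_ereal_sup => _ [e _ <-]; rewrite /hausdorff_pre mu_ext0 //.
    exact: hausdorff_weight0.
  exact: hausdorff_weight_ge0.
apply: ereal_sup_ubound; exists 1%R; first by rewrite /= ltr01.
rewrite /hausdorff_pre mu_ext0 //; first exact: hausdorff_weight0.
exact: hausdorff_weight_ge0.
Qed.

Lemma hausdorff_outer_ge0 k A : 0 <= hausdorff_outer k A.
Proof.
apply: le_trans (ereal_sup_ubound _); last first.
  by exists 1%R; [rewrite /= ltr01 | reflexivity].
by apply: mu_ext_ge0; exact: hausdorff_weight_ge0.
Qed.

Lemma le_hausdorff_outer k : {homo hausdorff_outer k : A B / A `<=` B >-> A <= B}.
Proof.
move=> A B AB; apply: ge_ereal_sup => _ [e e0 <-].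
apply: (@le_trans _ _ (hausdorff_pre k e B)); first exact: le_mu_ext.
by apply: ereal_sup_ubound; exists e.
Qed.

Lemma hausdorff_outer_sigma_subadditive k :
  sigma_subadditive (hausdorff_outer k).
Proof.
move=> F; apply: ge_ereal_sup => _ [e e0 <-].
apply: (@le_trans _ _ (\sum_(i <oo) hausdorff_pre k e (F i))).
  exact: (@mu_ext_sigma_subadditive _ (g_sigma_algebraType [set: set V]) R _
    (hausdorff_weight_ge0 k e)).
apply: lee_nneseries => i _.
  by move=> _; apply: mu_ext_ge0; exact: hausdorff_weight_ge0.
by apply: ereal_sup_ubound; exists e.
Qed.

HB.instance Definition _ k := isOuterMeasure.Build R V (hausdorff_outer k)
  (hausdorff_outer0 k) (hausdorff_outer_ge0 k) (@le_hausdorff_outer k)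
  (@hausdorff_outer_sigma_subadditive k).

Definition hausdorff (k : nat) :
    set (caratheodory_type (hausdorff_outer k)) -> \bar R :=
  hausdorff_outer k.

Arguments hausdorff k _ : clear implicits.

Lemma hausdorff0 k : hausdorff k set0 = 0.
Proof. exact: hausdorff_outer0. Qed.

Lemma hausdorff_ge0 k A : 0 <= hausdorff k A.
Proof. exact: hausdorff_outer_ge0. Qed.

Lemma hausdorff_semi_sigma_additive k : semi_sigma_additive (hausdorff k).
Proof. exact: caratheodory_measure_sigma_additive. Qed.

HB.instance Definition _ k := isMeasure.Build _ _ _ (hausdorff k)
  (hausdorff0 k) (@hausdorff_ge0 k) (@hausdorff_semi_sigma_additive k).

(* The integral of g over the k-dimensional set D. *)
Definition hint (k : nat) (D : set V) (g : V -> R) : R :=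
  Rintegral (hausdorff k) D g.

End hausdorff.

Arguments hausdorff {R d} k _.

Section calculus.
Context {R : realType} {d : nat}.
Local Notation V := 'rV[R]_d.

Definition partial (l : 'I_d) (g : V -> R) : V -> R := 'D_(delta_mx 0 l) g.

Definition grad (g : V -> R) (x : V) : V := \row_l partial l g x.

Fixpoint class_C (n : nat) (U : set V) (g : V -> R) : Prop :=
  (forall x, U x -> {for x, continuous g}) /\
  match n with
  | 0 => True
  | n'.+1 => forall l : 'I_d,
      (forall x, U x -> derivable g x (delta_mx 0 l)) /\
      class_C n' U (partial l g)
  end.

Definition smooth_on (S : set V) (g : V -> R) : Prop :=
  exists U : set V, [/\ open U, S `<=` U & forall n, class_C n U g].

Definition smooth_field (S : set V) (X : V -> V) : Prop :=
  forall k, smooth_on S (fun x => X x 0 k).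

Definition smooth_mxfield (S : set V) (A : V -> 'M[R]_d) : Prop :=
  forall k l, smooth_on S (fun x => A x k l).

Definition boundary (D : set V) : set V := closure D `\` interior D.

(* nu is the exterior unit normal to D at x: seen from x, D is to first order
   the half space {y | nu . (y - x) < 0}.  Where the boundary has a corner no
   nu qualifies. *)
Definition exterior_normal (D : set V) (x nu : V) : Prop :=
  dot nu nu = 1 /\
  forall e : R, 0 < e -> \forall y \near x,
    (D y -> dot nu (y - x) <= e * enorm (y - x)) /\
    (~ D y -> - (e * enorm (y - x)) <= dot nu (y - x)).

Definition smooth_hypersurface (S : set V) : Prop :=
  forall x, S x -> exists (U : set V) (phi : V -> R),
    [/\ open U, U x, smooth_on U phi, grad phi x != 0 &
        forall y, U y -> (S y <-> phi y = 0)].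

Definition convex_polytope (D : set V) : Prop :=
  exists (m : nat) (a : 'I_m -> V) (b : 'I_m -> R),
    D = [set x | forall j, dot (a j) x < b j].

(* conv P s is the convex hull of the points P j, j \in s. *)
Definition conv n (P : 'I_n -> V) (s : {set 'I_n}) : set V :=
  [set x | exists t : 'I_n -> R,
     [/\ forall j, 0 <= t j, forall j, j \notin s -> t j = 0,
         \sum_j t j = 1 & x = \sum_j t j *: P j]].

End calculus.

(* Om i is Omega_i: the interface for i = 0, the outer and the inner subdomain
   for i = 1, 2. *)
Definition i0 : 'I_3 := @Ordinal 3 0 isT.
Definition i1 : 'I_3 := @Ordinal 3 1 isT.
Definition i2 : 'I_3 := @Ordinal 3 2 isT.

Definition dim_of (d : nat) (i : 'I_3) : nat := if i == i0 then d.-1 else d.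

Record geometry (R : realType) (d : nat) := Geometry {
  Omega : set 'rV[R]_d;
  Om : 'I_3 -> set 'rV[R]_d;
  n0 : 'rV[R]_d -> 'rV[R]_d;

  geo_dim : (d == 2%N) || (d == 3%N);
  geo_polytope : convex_polytope Omega;
  geo_bounded : bounded_set Omega;
  geo_nonempty : Omega !=set0;

  geo_open : forall i, i != i0 -> open (Om i) /\ Om i !=set0;
  geo_connected : forall i, i != i0 -> connected (Om i);
  geo_partition : Omega = Om i0 `|` Om i1 `|` Om i2;
  geo_disjoint : forall i j, i != j -> Om i `&` Om j = set0;
  geo_boundary1 : boundary (Om i1) = boundary Omega `|` Om i0;
  geo_boundary2 : boundary (Om i2) = Om i0;

  geo_compact : compact (Om i0);
  geo_smooth : smooth_hypersurface (Om i0);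
  geo_tubular : exists delta : R, 0 < delta /\
    forall x y, Om i0 y -> enorm (x - y) < delta -> Omega x /\
      exists! p, Om i0 p /\ forall q, Om i0 q -> enorm (x - p) <= enorm (x - q);

  n0_normal : forall x, Om i0 x ->
    exterior_normal (Om i1) x (n0 x) \/ exterior_normal (Om i2) x (n0 x);
  n0_continuous : {within Om i0, continuous n0}
}.

Section operators.
Context {R : realType} {d : nat} (G : geometry R d).
Local Notation V := 'rV[R]_d.

(* Orthogonal projection onto the tangent space of Omega_i at x. *)
Definition tproj (i : 'I_3) (x v : V) : V :=
  if i == i0 then v - dot (n0 G x) v *: n0 G x else v.

(* div_i X is the contraction of nabla_i X. *)
Definition divi (i : 'I_3) (X : V -> V) (x : V) : R :=
  \sum_(k < d) tproj i x (grad (fun y => X y 0 k) x) 0 k.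

Definition tangential (i : 'I_3) (X : V -> V) : Prop :=
  if i == i0 then forall x, Om G i0 x -> dot (n0 G x) (X x) = 0
  else forall x nu, boundary (Om G i) x -> exterior_normal (Om G i) x nu ->
    dot nu (X x) = 0.

End operators.

(* P1 on one element: (c, g) stands for x |-> c + g . x, whose gradient is g. *)
Definition P1 (R : realType) (d : nat) : Type := (R * 'rV[R]_d)%type.
Definition ev {R : realType} {d : nat} (p : P1 R d) (x : 'rV[R]_d) : R :=
  p.1 + dot p.2 x.

Section simplices.
Context {R : realType} {d : nat} {I : finType} (vtx : I -> 'I_d.+1 -> 'rV[R]_d).

Definition simplex (K : I) : set 'rV[R]_d := conv (vtx K) [set: 'I_d.+1]%SET.

Definition facet (K : I) (j : 'I_d.+1) : set 'rV[R]_d := conv (vtx K) [set~ j]%SET.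

Definition shared (K L : I) : {set 'I_d.+1} :=
  [set j | [exists l, vtx L l == vtx K j]]%SET.

(* K and L share a face, which is then K /\ L. *)
Definition adj (K L : I) : bool := (K != L) && (#|shared K L| == d).

Definition facet_normal (K L : I) (nu : 'rV[R]_d) : Prop :=
  [/\ dot nu nu = 1,
      forall x y, (simplex K `&` simplex L) x -> (simplex K `&` simplex L) y ->
        dot nu (y - x) = 0 &
      forall x y, (simplex K `&` simplex L) x -> simplex K y ->
        dot nu (y - x) <= 0].

End simplices.

Section cut_elements.
Context {R : realType} {d : nat} (G : geometry R d).
Context {I : finType} (vtx : I -> 'I_d.+1 -> 'rV[R]_d) (nu : I -> I -> 'rV[R]_d).
Local Notation V := 'rV[R]_d.

Definition elements (i : 'I_3) : {set I} :=
  [set K | `[< simplex vtx K `&` Om G i !=set0 >]]%SET.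

Definition cut (i : 'I_3) (K : I) : set V := simplex vtx K `&` Om G i.

Definition cut_face (i : 'I_3) (K L : I) : set V :=
  simplex vtx K `&` simplex vtx L `&` Om G i.

(* The exterior unit normal of K on K /\ L for i = 1, 2; for i = 0 the exterior
   unit co-normal of K /\ Omega_0, the normalized tangential part of the former. *)
Definition conormal (i : 'I_3) (K L : I) (x : V) : V :=
  let t := tproj G i x (nu K L) in (enorm t)^-1 *: t.

(* The cut element K /\ Omega_i is a Green domain: it and the pieces of its
   boundary on the faces of K have finite measure, and Gauss' theorem holds on it
   with [conormal] as exterior unit (co-)normal.  Fields that are tangential to
   the boundary of Omega_i suffice; for them K /\ Omega_0 carries no flux.
   For i = 0 this asks that Omega_0 meets the faces of K in general position. *)
Definition green_cut (i : 'I_3) (K : I) : Prop :=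
  [/\ (hausdorff (dim_of d i) (cut i K) < +oo)%E,
      forall L, adj vtx K L ->
        (hausdorff (dim_of d i).-1 (cut_face i K L) < +oo)%E &
      forall X : V -> V,
        smooth_field (closure (Om G i)) X -> tangential G i X ->
        hint (dim_of d i) (cut i K) (divi G i X) =
        \sum_(L | adj vtx K L)
          hint (dim_of d i).-1 (cut_face i K L)
               (fun x => dot (conormal i K L x) (X x))].

End cut_elements.

Record mesh (R : realType) (d : nat) (G : geometry R d) := Mesh {
  cell : finType;
  vtx : cell -> 'I_d.+1 -> 'rV[R]_d;
  nrm : cell -> cell -> 'rV[R]_d;
  ordered : rel cell;
  meshsize : R;
  shape_cst : R;
  unif_cst : R;

  mesh_size_gt0 : 0 < meshsize;
  mesh_csts : 0 < shape_cst /\ 0 < unif_cst;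
  mesh_nondegenerate : forall K,
    row_free (\matrix_(j < d) (vtx K (lift ord0 j) - vtx K ord0));
  mesh_cover : closure (Omega G) = [set x | exists K, simplex vtx K x];
  mesh_conforming : forall K L, K != L ->
    shared vtx K L != [set: 'I_d.+1]%SET /\
    simplex vtx K `&` simplex vtx L = conv (vtx K) (shared vtx K L);
  mesh_shape_regular : forall K, exists y, forall z,
    ((shape_cst * enorm (z - y))%:E <= ediam (simplex vtx K))%E -> simplex vtx K z;
  mesh_quasiuniform : forall K,
    (ediam (simplex vtx K) <= meshsize%:E <= unif_cst%:E * ediam (simplex vtx K))%E;

  nrm_normal : forall K L, adj vtx K L -> facet_normal vtx K L (nrm K L);
  (* which of the two elements sharing a face is T_1 *)
  ordered_enum : forall K L, adj vtx K L -> ordered K L = ~~ ordered L K;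
  mesh_green : forall i K, K \in elements G vtx i -> green_cut G vtx nrm i K
}.

Arguments meshsize {R d G}.

Section mesh_notions.
Context {R : realType} {d : nat} {G : geometry R d} (T : mesh G).
Local Notation V := 'rV[R]_d.

Definition Th (i : 'I_3) : {set cell T} := elements G (@vtx _ _ _ T) i.

(* The interior faces of a set of elements, as pairs (T_1, T_2). *)
Definition faces (D : {set cell T}) : {set cell T * cell T} :=
  [set p | [&& p.1 \in D, p.2 \in D, adj (@vtx _ _ _ T) p.1 p.2
             & ordered p.1 p.2]]%SET.

(* The faces of F_{h,i} on the boundary of M, with T_1 in M. *)
Definition boundary_faces (i : 'I_3) (M : {set cell T}) : {set cell T * cell T} :=
  [set p | [&& p.1 \in M, p.2 \in Th i, p.2 \notin M
             & adj (@vtx _ _ _ T) p.1 p.2]]%SET.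

Definition bd_facet (K : cell T) (j : 'I_d.+1) : Prop :=
  facet (@vtx _ _ _ T) K j `<=` boundary (Omega G).

(* Integrals of elementwise defined integrands: [int_el i D g] is the integral of
   g over the union of T /\ Omega_i, T in D; [int_cut_faces] and [int_faces] are
   over F /\ Omega_i and over the whole faces F.  Distinct T /\ Omega_i overlap in
   null sets only. *)
Definition int_el (i : 'I_3) (D : {set cell T}) (g : cell T -> V -> R) : R :=
  \sum_(K in D) hint (dim_of d i) (cut G (@vtx _ _ _ T) i K) (g K).

Definition int_cut_faces (i : 'I_3) (F : {set cell T * cell T})
    (g : cell T -> cell T -> V -> R) : R :=
  \sum_(p in F) hint (dim_of d i).-1 (cut_face G (@vtx _ _ _ T) i p.1 p.2)
    (g p.1 p.2).

Definition int_faces (F : {set cell T * cell T}) (g : cell T -> cell T -> V -> R) : R :=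
  \sum_(p in F) hint d.-1
    (simplex (@vtx _ _ _ T) p.1 `&` simplex (@vtx _ _ _ T) p.2) (g p.1 p.2).

Definition large_intersection (gamma : R) (i : 'I_3) (K : cell T) : Prop :=
  (gamma%:E * ediam (simplex (@vtx _ _ _ T) K) ^+ (dim_of d i) <=
   hausdorff (dim_of d i) (cut G (@vtx _ _ _ T) i K))%E.

(* N bounds the number of faces of M crossed on the way from T_M to T. *)
Definition macro_partition (gamma : R) (N : nat) (i : 'I_3)
    (P : {set {set cell T}}) : Prop :=
  finset.partition P (Th i) /\
  forall M, M \in P -> exists TM, [/\ TM \in M, large_intersection gamma i TM &
    forall K, K \in M -> exists s : seq (cell T),
      [/\ path (adj (@vtx _ _ _ T)) TM s, all (mem M) s, last TM s = K &
          (size s <= N)%N]].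

(* Discontinuous P1 functions vanishing on the boundary of Omega. *)
Definition in_Vh (v : cell T -> P1 R d) : Prop :=
  forall K j, bd_facet K j ->
    forall x, facet (@vtx _ _ _ T) K j x -> ev (v K) x = 0.

(* W_h: the component v i is used on the elements of T_{h,i} only. *)
Definition in_Wh (v : 'I_3 -> cell T -> P1 R d) : Prop := forall i, in_Vh (v i).

End mesh_notions.

Record problem (R : realType) (d : nat) (G : geometry R d) := Problem {
  beta : 'I_3 -> 'rV[R]_d -> 'rV[R]_d;
  diffusion : 'I_3 -> 'rV[R]_d -> 'M[R]_d;
  kappa : 'I_3 -> R;
  kappa0 : 'I_3 -> R;
  source : 'I_3 -> 'rV[R]_d -> R;

  beta_smooth : forall i, smooth_field (closure (Om G i)) (beta i);
  beta_tangential : forall i, tangential G i (beta i);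
  beta_div : forall i x, Om G i x -> divi G i (beta i) x = 0;
  diffusion_smooth : forall i, smooth_mxfield (closure (Om G i)) (diffusion i);
  diffusion_posdef : forall i, exists c : R, 0 < c /\
    forall x xi, Om G i x -> (i = i0 -> dot (n0 G x) xi = 0) ->
      c * dot xi xi <= dot xi (xi *m (diffusion i x)^T);
  kappa_gt0 : forall i, i != i0 -> 0 < kappa i /\ 0 < kappa0 i;
  source_integrable : forall i,
    (hausdorff (dim_of d i)).-integrable (Om G i) (EFin \o source i)
}.

Record discretization (R : realType) (d : nat) (G : geometry R d) (T : mesh G) :=
  Discretization {
  macros : 'I_3 -> {set {set cell T}};
  gamma : 'I_3 -> R;
  macro_cst : nat;
  (* theta T_1 T_2 is the weight of T_1 on the face shared by T_1 and T_2 *)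
  theta : cell T -> cell T -> R;
  tau_a : 'I_3 -> R;
  tau_b : 'I_3 -> R;
  tau : 'I_3 -> nat -> R;

  gamma_gt0 : forall i, 0 < gamma i;
  macros_partition : forall i, macro_partition (gamma i) macro_cst i (macros i);
  theta_ge0 : forall K L, adj (@vtx _ _ _ T) K L -> 0 <= theta K L;
  theta_sum : forall K L, adj (@vtx _ _ _ T) K L -> theta K L + theta L K = 1;
  tau_a_gt0 : forall i, 0 < tau_a i;
  tau_b_ge0 : forall i, 0 <= tau_b i;
  tau_gt0 : forall i k, 0 < tau i k
}.

Section method.
Context {R : realType} {d : nat} {G : geometry R d} {T : mesh G}.
Context (P : problem G) (S : discretization T).
Local Notation V := 'rV[R]_d.
Local Notation el := (cell T).
Local Notation h := (meshsize T).

Implicit Types (i : 'I_3) (v w : el -> P1 R d) (K L : el) (x : V).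

Definition conu i K L x : V := conormal G (@nrm _ _ _ T) i K L x.

(* nabla_i v and A_i nabla_i v on the element K *)
Definition nab i v K x : V := tproj G i x (v K).2.
Definition Anab i v K x : V := nab i v K x *m (diffusion P i x)^T.

Definition jump v K L x : R := ev (v K) x - ev (v L) x.
Definition avg v K L x : R :=
  theta S K L * ev (v K) x + theta S L K * ev (v L) x.
Definition avg_flux i v K L x : R :=
  theta S K L * dot (conu i K L x) (Anab i v K x)
  - theta S L K * dot (conu i L K x) (Anab i v L x).

Definition nu_beta i K L x : R := dot (conu i K L x) (beta P i x).

Definition lambda_a i K L x : R :=
  tau_a S i * dot (conu i K L x) (conu i K L x *m (diffusion P i x)^T).
Definition lambda_b i K L x : R := tau_b S i * `|nu_beta i K L x|.

Definition a_h i v w : R :=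
  int_el i (Th T i) (fun K x => dot (Anab i v K x) (nab i w K x))
  - int_cut_faces i (faces (Th T i))
      (fun K L x => avg_flux i v K L x * jump w K L x)
  - int_cut_faces i (faces (Th T i))
      (fun K L x => jump v K L x * avg_flux i w K L x)
  + int_cut_faces i (faces (Th T i))
      (fun K L x => lambda_a i K L x * h^-1 * jump v K L x * jump w K L x).

Definition b_h i v w : R :=
  2^-1 * (int_el i (Th T i)
            (fun K x => dot (beta P i x) (nab i v K x) * ev (w K) x)
          - int_el i (Th T i)
              (fun K x => ev (v K) x * dot (beta P i x) (nab i w K x)))
  + 2^-1 * (int_cut_faces i (faces (Th T i))
              (fun K L x => nu_beta i K L x * avg v K L x * jump w K L x)
            - int_cut_faces i (faces (Th T i))
                (fun K L x => nu_beta i K L x * jump v K L x * avg w K L x))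
  + int_cut_faces i (faces (Th T i))
      (fun K L x => lambda_b i K L x * jump v K L x * jump w K L x).

(* ([nabla^k v], [nabla^k w]) over the full faces of M, k = 0, 1 *)
Definition jump_prod (M : {set el}) (k : nat) v w : R :=
  int_faces (faces M) (fun K L x =>
    if k == 0%N then jump v K L x * jump w K L x
    else dot ((v K).2 - (v L).2) ((w K).2 - (w L).2)).

Definition s_hM i (M : {set el}) v w : R :=
  if i == i0 then
    \sum_(0 <= k < 2) tau S i k * h ^ ((2 * k)%:Z - 2) * jump_prod M k v w
    + tau S i 2 * h ^+ 2 *
      int_el i0 M (fun K x => dot (n0 G x) (v K).2 * dot (n0 G x) (w K).2)
  else
    \sum_(0 <= k < 2) tau S i k * h ^ ((2 * k)%:Z - 1) * jump_prod M k v w.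

Definition s_h i v w : R := \sum_(M in macros S i) s_hM i M v w.

Definition kappat i : R := if i == i0 then 1 else kappa P i / kappa0 P i.

Definition kjump i (v : 'I_3 -> el -> P1 R d) K x : R :=
  kappa P i * ev (v i K) x - kappa0 P i * ev (v i0 K) x.

Definition A_h (v w : 'I_3 -> el -> P1 R d) : R :=
  \sum_i kappat i *
    (a_h i (v i) (w i) + b_h i (v i) (w i) + s_h i (v i) (w i))
  + \sum_(i | i != i0)
      int_el i0 (Th T i0) (fun K x => (kappa0 P i)^-1 * kjump i v K x * kjump i w K x).

Definition L_h (v : 'I_3 -> el -> P1 R d) : R :=
  \sum_i int_el i (Th T i) (fun K x => source P i x * (kappat i * ev (v i K) x)).

Definition Sigma_n i v K L x : R :=
  avg_flux i v K L x
  - (h^-1 * lambda_a i K L x + lambda_b i K L x) * jump v K L x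
  - nu_beta i K L x * avg v K L x.

(* (nu_i . beta_i) (<v> - (v_1 + v_2) / 2), which is zero for the weights 1/2.
   Whatever theta is, testing b_h with an indicator function produces the
   arithmetic mean of v, not <v>, in the convective flux. *)
Definition weight_defect i v K L x : R :=
  (theta S K L - 2^-1) * nu_beta i K L x * jump v K L x.

(* No element of M has a facet on the boundary of Omega: this is what puts the
   indicator function of M in V_h. *)
Definition interior_macro (M : {set el}) : Prop :=
  forall K j, K \in M -> ~ bd_facet K j.

End method.

(* Main.v *)
Require Import Defs.
From mathcomp Require Import all_boot all_order all_algebra.
From mathcomp Require Import all_classical all_reals all_analysis.
From mathcomp Require Import measurable_realfun.
From mathcomp Require Import ring.

(* The equation is tested with the indicator function of the macro element M,
   placed in component i.  All gradients of the test function vanish, and so do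
   its jumps inside every macro element, so the stabilization drops out.  Gauss'
   theorem on each K in M for the field u_h beta_i turns the remaining volume
   convection term into integrals over the faces of K.  After this, each interior
   face contributes a quantity that is symmetric in its two elements, vanishes
   unless exactly one of them lies in M, and then equals minus the normal flux
   Sigma_n together with its weight defect.  Rearranging uses nu_1 = - nu_2 on a
   shared face, which holds because the mesh is conforming, and linearity of the
   integrals, hence measurability of the integrands: Borel sets are
   Caratheodory measurable for the Hausdorff outer measure because it is a metric
   outer measure. *)

Set Implicit Arguments.
Unset Strict Implicit.
Unset Printing Implicit Defensive.

Import Order.TTheory GRing.Theory Num.Theory.
Import numFieldNormedType.Exports.

Local Open Scope classical_set_scope.
Local Open Scope ring_scope.

(** * Borel sets are measurable for the Hausdorff measure *)

Section metric_outer_measure.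
Context {R : realType} {V : normedModType R}.
Variable mu : {outer_measure set V -> \bar R}.
Hypothesis mu_metric : forall (A B : set V) (r : R), 0 < r ->
  (forall x y, A x -> B y -> r <= `|x - y|) ->
  (mu A + mu B <= mu (A `|` B))%E.

(** The sets [far C n] grow with [n] and, for closed [C], exhaust its complement; the differences of
    consecutive ones are the shells of Carathéodory's criterion. *)
Let far (C : set V) (n : nat) : set V :=
  [set x | forall c, C c -> n.+1%:R^-1 <= `|x - c|].

Let far_mono C m n : (m <= n)%N -> far C m `<=` far C n.
Proof.
move=> mn x Dx c Cc; apply: le_trans (Dx c Cc).
by rewrite lef_pV2 ?posrE// ler_nat.
Qed.

Let far_gap (n : nat) : 0 < (n.+1%:R^-1 - n.+2%:R^-1 : R).
Proof. by rewrite subr_gt0 ltf_pV2 ?posrE// ltr_nat. Qed.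

Let far_shell C n x y : far C n x -> (far C n.+2 `\` far C n.+1) y ->
  n.+1%:R^-1 - n.+2%:R^-1 <= `|x - y|.
Proof.
move=> Dx [_ /existsNP[c /not_implyP[Cc /negP]]]; rewrite -ltNge => yc.
rewrite lerBlDr (le_trans (Dx c Cc))// (le_trans (ler_distD y x c))// lerD2l.
exact: ltW.
Qed.

(** Carathéodory's criterion: [X] minus [C] is approximated by its part in [far C n], which is
    separated from [C]. The error is covered by thin shells near [C], whose measures form a
    convergent series with vanishing tail. *)
Lemma closed_caratheodory (C : set V) : closed C -> mu.-caratheodory C.
Proof.
move=> clC; apply: le_caratheodory_measurable => X.
have [->|Xfin] := eqVneq (mu X) +oo%E; first by rewrite leey.
have {}Xfin : (mu X < +oo)%E by rewrite ltey.
pose s n := mu (X `&` (far C n.+2 `\` far C n.+1)).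
pose d n := mu (X `&` far C n).
have dX n : (d n <= mu X)%E by apply: le_outer_measure => x [].
have dC n : (mu (X `&` C) + d n <= mu X)%E.
  apply: (@le_trans _ _ (mu ((X `&` C) `|` (X `&` far C n)))); last first.
    by apply: le_outer_measure => x [[]|[]].
  apply: (@mu_metric _ _ n.+1%:R^-1); first by rewrite invr_gt0.
  by move=> x y [_ Cx] [_ Dy]; rewrite distrC; exact: Dy.
(* The layer between [far C n] and the shell [s n] is skipped, so the two sets are a positive
   distance apart and their measures add. *)
have sd n : (s n + d n <= d n.+2)%E.
  rewrite addeC; apply: (@le_trans _ _ (mu ((X `&` far C n) `|`
    (X `&` (far C n.+2 `\` far C n.+1))))); last first.
    apply: le_outer_measure => x [[? ?]|[? []//]]; split => //.
    exact: far_mono (leq_trans (leqnSn _) (leqnSn _)) _ _.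
  apply: (mu_metric (far_gap n)) => x y [_ Dx] [_ Dy]; exact: (far_shell Dx Dy).
have s0 n : (0 <= s n)%E by exact: outer_measure_ge0.
have d0 n : (0 <= d n)%E by exact: outer_measure_ge0.
(* Only every second shell is separated from the previous ones, so even and odd shells are absorbed
   in two different terms [d]; this bounds the series by twice [mu X]. *)
have tele n : (\sum_(0 <= k < n) s k <= d n + d n.+1)%E.
  elim: n => [|n IH]; first by rewrite big_geq// adde_ge0.
  rewrite big_nat_recr//= addeC.
  apply: (le_trans (leeD2l _ IH)); rewrite addeA addeC.
  exact: leeD2l.
have sfin : (\sum_(k <oo) s k < +oo)%E.
  apply: (@le_lt_trans _ _ (mu X + mu X)%E); last by rewrite lte_add_pinfty.
  apply: lime_le; first exact: is_cvg_nneseries.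
  by apply: nearW => n; apply: (le_trans (tele n)); exact: leeD.
have tail := nneseries_tail_cvg sfin (fun k _ => s0 k).
have key n : (mu (X `&` C) + mu (X `&` ~` C) <=
    mu X + \sum_(n <= k <oo) s k)%E.
  apply: (@le_trans _ _ (mu (X `&` C) + (d n.+1 + \sum_(n <= k <oo) s k))%E).
    apply: leeD2l.
    apply: (@le_trans _ _ (mu ((X `&` far C n.+1) `|`
      \bigcup_(k in ~` `I_n) (X `&` (far C k.+2 `\` far C k.+1))))).
      apply: le_outer_measure => x [Xx nCx].
      (* Closedness of [C] enters here: a point outside [C] has a ball that avoids [C]. *)
      have [m Dm] : exists m, far C m x.
        have : open (~` C) by exact: closed_openC.
        rewrite openE => /(_ x nCx) /nbhs_ballP [e /= e0 be].
        have [m me] := ltr_add_invr e0.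
        exists m => c Cc; rewrite leNgt; apply/negP => xc; apply: (be c) => //.
        by rewrite -ball_normE /=; apply: lt_trans xc _; rewrite add0r in me.
      have [nD|nD] := pselect (far C n.+1 x); first by left.
      (* The least layer containing [x] has index greater than [n.+1], so [x] lies in a shell of the
         tail. *)
      right; elim: m Dm => [|k IH] Dk; first by case: nD; exact: far_mono Dk.
      have [/IH//|Dk'] := pselect (far C k x).
      have nk : (n < k)%N.
        by rewrite ltnNge; apply/negP => kn; apply: nD; exact: far_mono Dk.
      case: k nk Dk Dk' {IH} => // k nk Dk Dk'.
      by exists k => //=; apply/negP; rewrite -leqNgt.
    apply: (le_trans (outer_measureU2 _ _ _)); apply: leeD2l.
    exact: outer_measure_sigma_subadditive_tail.
  by rewrite addeA leeD2r.
have lim : (mu X + \sum_(n <= k <oo) s k)%E @[n --> \oo] --> mu X.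
  rewrite -[X in _ --> X]adde0; apply: cvgeD => //; last exact: cvg_cst.
  by apply: ge0_adde_def; rewrite inE; [exact: outer_measure_ge0 | exact: lexx].
rewrite -(cvg_lim _ lim)//; apply: lime_ge; last exact: nearW.
by apply/cvg_ex; exists (mu X).
Qed.
End metric_outer_measure.

Section euclidean_norm.
Context {R : realType} {d : nat}.
Implicit Types x y z : 'rV[R]_d.

Lemma coord_le_enorm x k : `|x 0 k| <= enorm x.
Proof.
rewrite -sqrtr_sqr; apply: ler_wsqrtr; rewrite /dot (bigD1 k)//= expr2 lerDl.
by apply: sumr_ge0 => j _; rewrite -expr2 sqr_ge0.
Qed.

(** Separation of sets is measured in the sup norm, diameters in the Euclidean norm; this comparison
    links them. *)
Lemma norm_le_enorm x : `|x| <= enorm x.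
Proof.
rewrite [leLHS]/Num.norm/= mx_normrE; apply: bigmax_le; first exact: sqrtr_ge0.
by move=> [i k] _ /=; rewrite ord1; exact: coord_le_enorm.
Qed.

End euclidean_norm.

Section hausdorff_borel.
Context {R : realType} {d : nat}.
Local Notation V := 'rV[R]_d.
Local Open Scope ereal_scope.

Lemma hausdorff_weight_anti k (a b : R) (C : set V) : (a <= b)%R ->
  hausdorff_weight k b C <= hausdorff_weight k a C.
Proof.
move=> ab; rewrite /hausdorff_weight; case: asboolP => // _.
case: (boolP (_ <= a%:E)) => [Ca|_]; last exact: leey.
by rewrite (le_trans Ca) ?lee_fin.
Qed.

Lemma hausdorff_pre_anti k (a b : R) (C : set V) : (a <= b)%R ->
  hausdorff_pre k b C <= hausdorff_pre k a C.
Proof.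
move=> ab; apply: le_ereal_inf_tmp => _ [F CF <-].
apply: (@le_trans _ _ (\sum_(i <oo) hausdorff_weight k b (F i))).
  by apply: ereal_inf_lbound; exists F.
apply: lee_nneseries => i _; first by move=> _; exact: hausdorff_weight_ge0.
exact: hausdorff_weight_anti.
Qed.

(* A set of diameter below [r] meets at most one of [A] and [B]. *)
Lemma hausdorff_pre_metric k (delta r : R) (A B : set V) : (delta < r)%R ->
  (forall x y, A x -> B y -> (r <= `|x - y|)%R) ->
  hausdorff_pre k delta A + hausdorff_pre k delta B <=
  hausdorff_pre k delta (A `|` B).
Proof.
move=> dr AB; apply: le_ereal_inf_tmp => _ [F [mF UF] <-].
(* A cover of the union is split into a cover of [A] and one of [B] by emptying the members that
   miss the set in question. *)
pose FI (D : set V) i := if `[< F i `&` D !=set0 >] then F i else set0.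
have FIcover (D : set V) : D `<=` A `|` B ->
    hausdorff_pre k delta D <= \sum_(i <oo) hausdorff_weight k delta (FI D i).
  move=> DAB; apply: ereal_inf_lbound; exists (FI D) => //; split.
    by move=> i; exact: sub_sigma_algebra.
  move=> x Dx; have [i _ Fx] := UF x (DAB _ Dx).
  by exists i => //; rewrite /FI; case: asboolP => // -[]; exists x.
have w0 (C : set V) : 0 <= hausdorff_weight k delta C.
  exact: hausdorff_weight_ge0.
apply: (@le_trans _ _ (\sum_(i <oo) (hausdorff_weight k delta (FI A i) +
                                     hausdorff_weight k delta (FI B i)))).
  rewrite nneseriesD; try by move=> *; exact: w0.
  by apply: leeD; apply: FIcover => x; [left|right].
apply: lee_nneseries => i _; first by move=> _; rewrite adde_ge0.
rewrite /FI; case: asboolP => [[x [Fx Ax]]|_]; last first.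
  by rewrite hausdorff_weight0 add0e; case: asboolP => // _; rewrite hausdorff_weight0.
case: asboolP => [[y [Fy By]]|_]; last by rewrite hausdorff_weight0 adde0.
suff -> : hausdorff_weight k delta (F i) = +oo by [].
rewrite /hausdorff_weight; case: asboolP => [F0|_]; first by rewrite F0 in Fx.
suff /negbTE -> : ~~ (ediam (F i) <= delta%:E) by [].
rewrite -ltNge; apply: (@lt_le_trans _ _ (enorm (x - y))%:E).
  by rewrite lte_fin (lt_le_trans dr)// (le_trans (AB x y Ax By))// norm_le_enorm.
by apply: ereal_sup_ubound; exists x, y.
Qed.

(** At scales below [r] the pre-measures are already superadditive. The scales for [A] and [B] are
    kept independent, so that the two suprema can be taken one after the other. *)
Lemma hausdorff_outer_metric k (A B : set V) (r : R) : (0 < r)%R ->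
  (forall x y, A x -> B y -> (r <= `|x - y|)%R) ->
  hausdorff_outer k A + hausdorff_outer k B <= hausdorff_outer k (A `|` B).
Proof.
move=> r0 AB; set U := hausdorff_outer k (A `|` B).
have key (a b : R) : (0 < a)%R -> (0 < b)%R ->
    hausdorff_pre k a A + hausdorff_pre k b B <= U.
  move=> a0 b0; pose e := (Num.min (Num.min a b) (r / 2))%R.
  have e0 : (0 < e)%R by rewrite !lt_min a0 b0 divr_gt0.
  apply: (@le_trans _ _ (hausdorff_pre k e (A `|` B))); last first.
    by apply: ereal_sup_ubound; exists e.
  apply: (@le_trans _ _ (hausdorff_pre k e A + hausdorff_pre k e B)).
    by apply: leeD; apply: hausdorff_pre_anti; rewrite !ge_min lexx ?orbT.
  apply: (@hausdorff_pre_metric _ _ r) => //.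
  by rewrite !gt_min ltr_pdivrMr// ltr_pMr// ltr1n orbT.
have [->|Ufin] := eqVneq U +oo; first by rewrite leey.
have U0 : 0 <= U by exact: hausdorff_outer_ge0.
have Uf : U \is a fin_num by rewrite ge0_fin_numE// ltey.
have fin (C : set V) : C `<=` A `|` B -> hausdorff_outer k C \is a fin_num.
  move=> CU; rewrite ge0_fin_numE ?hausdorff_outer_ge0//.
  by rewrite (le_lt_trans (le_hausdorff_outer k CU))// ltey.
have prefin a (C : set V) : (0 < a)%R -> C `<=` A `|` B ->
    hausdorff_pre k a C \is a fin_num.
  move=> a0 CU; rewrite ge0_fin_numE; last first.
    by apply: mu_ext_ge0; exact: hausdorff_weight_ge0.
  apply: le_lt_trans (_ : hausdorff_outer k C < _).
    by apply: ereal_sup_ubound; exists a.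
  by rewrite -ge0_fin_numE ?fin// hausdorff_outer_ge0.
have [AU BU] : A `<=` A `|` B /\ B `<=` A `|` B by split=> x; [left|right].
(* All quantities are finite here, so each summand can be moved across the inequality while the
   supremum of the other is taken. *)
rewrite -leeBrDr ?fin//; apply: ge_ereal_sup => _ [a /= a0 <-].
rewrite leeBrDr ?fin// addeC -leeBrDr ?prefin//.
apply: ge_ereal_sup => _ [b /= b0 <-].
by rewrite leeBrDr ?prefin// addeC key.
Qed.

Lemma hausdorff_outer_caratheodory k (C : set V) : closed C ->
  (hausdorff_outer k).-caratheodory C.
Proof. exact/closed_caratheodory/hausdorff_outer_metric. Qed.

Local Notation Vk k := (caratheodory_type (@hausdorff_outer R d k)).

Lemma closed_hausdorff_measurable k (C : set V) : closed C ->
  measurable (C : set (Vk k)).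
Proof. exact: hausdorff_outer_caratheodory. Qed.

Lemma open_hausdorff_measurable k (U : set V) : open U ->
  measurable (U : set (Vk k)).
Proof.
move=> oU; rewrite -(setCK U); apply: measurableC.
exact/closed_hausdorff_measurable/open_closedC.
Qed.

End hausdorff_borel.

(** * Integrals of bounded measurable functions *)

Section bounded_measurable.
Context {disp : measure_display} {T : measurableType disp} {R : realType}.
Implicit Types (D E : set T) (f g : T -> R).

(** Unlike integrable functions, this class is closed under products, and it consists of integrable
    functions on measurable sets of finite measure. *)
Definition bounded_mfun D f : Prop :=
  measurable_fun D f /\ exists C : R, forall x, D x -> `|f x| <= C.

Lemma bounded_mfun_cst D c : bounded_mfun D (fun=> c).
Proof. by split; [exact: measurable_cst | exists `|c|]. Qed.

Lemma bounded_mfunD D f g : bounded_mfun D f -> bounded_mfun D g ->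
  bounded_mfun D (fun x => f x + g x).
Proof.
move=> [mf [C fC]] [mg [C' gC]]; split; first exact: measurable_funD.
by exists (C + C') => x Dx; rewrite (le_trans (ler_normD _ _))// lerD ?fC ?gC.
Qed.

Lemma bounded_mfunM D f g : bounded_mfun D f -> bounded_mfun D g ->
  bounded_mfun D (fun x => f x * g x).
Proof.
move=> [mf [C fC]] [mg [C' gC]]; split; first exact: measurable_funM.
by exists (C * C') => x Dx; rewrite normrM ler_pM ?fC ?gC.
Qed.

Lemma bounded_mfunN D f : bounded_mfun D f -> bounded_mfun D (fun x => - f x).
Proof.
move=> [mf [C fC]]; split; first exact: measurable_funN.
by exists C => x Dx; rewrite normrN fC.
Qed.

Lemma bounded_mfunB D f g : bounded_mfun D f -> bounded_mfun D g ->
  bounded_mfun D (fun x => f x - g x).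
Proof. by move=> bf bg; apply/bounded_mfunD/bounded_mfunN. Qed.

Lemma bounded_mfun_norm D f : bounded_mfun D f ->
  bounded_mfun D (fun x => `|f x|).
Proof.
move=> [mf [C fC]]; split; first exact: measurableT_comp.
by exists C => x Dx; rewrite normr_id fC.
Qed.

Lemma bounded_mfun_sum D (I : Type) (r : seq I) (F : I -> T -> R) :
  (forall i, bounded_mfun D (F i)) ->
  bounded_mfun D (fun x => \sum_(i <- r) F i x).
Proof.
move=> bF; elim: r => [|i r IH].
  under eq_fun do rewrite big_nil; exact: bounded_mfun_cst.
by under eq_fun do rewrite big_cons; exact: bounded_mfunD.
Qed.

Lemma bounded_mfunS E D f : measurable E -> D `<=` E -> bounded_mfun E f ->
  bounded_mfun D f.
Proof.
move=> mE DE [mf [C fC]]; split; first exact: measurable_funS mf.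
by exists C => x /DE /fC.
Qed.

Lemma bounded_mfun_integrable (mu : {measure set T -> \bar R}) D f :
  measurable D -> (mu D < +oo)%E -> bounded_mfun D f ->
  mu.-integrable D (EFin \o f).
Proof.
move=> mD Dfin [mf [C fC]]; apply: measurable_bounded_integrable => //.
by exists C; split; [exact: num_real | move=> M CM x /fC /le_trans; apply; exact: ltW].
Qed.

Lemma measurable_fun_inv D f : measurable_fun D f -> (forall x, D x -> 0 <= f x) ->
  measurable_fun D (fun x => (f x)^-1).
Proof.
(* The inverse is the power with exponent -1, which is measurable; at zeros of [f] both expressions
   are 0 by convention. *)
move=> mf f0; apply: (eq_measurable_fun (fun x => f x `^ (-1))).
  by move=> x /set_mem Dx; rewrite powR_inv1 ?f0.
exact: (measurableT_comp (measurable_powR (-1))) mf.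
Qed.

End bounded_measurable.

(** * Integration of bounded functions against the Hausdorff measure *)

Section hausdorff_integral.
Context {R : realType} {d : nat} (k : nat).
Local Notation V := 'rV[R]_d.
Local Notation Vk := (caratheodory_type (@hausdorff_outer R d k)).

Definition hmeasurable (D : set V) : Prop := measurable (D : set Vk).

Definition hbounded (D : set V) (f : V -> R) : Prop :=
  @bounded_mfun _ Vk R D f.

Definition hfinite (D : set V) : Prop :=
  hmeasurable D /\ (hausdorff k D < +oo)%E.

Lemma hbounded_cst (D : set V) (c : R) : hbounded D (fun=> c).
Proof. exact: (@bounded_mfun_cst _ Vk R D c). Qed.

Lemma hboundedD (D : set V) (f g : V -> R) : hbounded D f -> hbounded D g ->
  hbounded D (fun x => f x + g x).
Proof. exact: (@bounded_mfunD _ Vk R D f g). Qed.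

Lemma hboundedB (D : set V) (f g : V -> R) : hbounded D f -> hbounded D g ->
  hbounded D (fun x => f x - g x).
Proof. exact: (@bounded_mfunB _ Vk R D f g). Qed.

Lemma hboundedM (D : set V) (f g : V -> R) : hbounded D f -> hbounded D g ->
  hbounded D (fun x => f x * g x).
Proof. exact: (@bounded_mfunM _ Vk R D f g). Qed.

Lemma hbounded_norm (D : set V) (f : V -> R) : hbounded D f ->
  hbounded D (fun x => `|f x|).
Proof. exact: (@bounded_mfun_norm _ Vk R D f). Qed.

Lemma hbounded_sum (D : set V) (I : Type) (r : seq I) (F : I -> V -> R) :
  (forall i, hbounded D (F i)) -> hbounded D (fun x => \sum_(i <- r) F i x).
Proof. exact: (@bounded_mfun_sum _ Vk R D I r F). Qed.

Lemma hbounded_integrable D f : hfinite D -> hbounded D f ->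
  (hausdorff k).-integrable (D : set Vk) (EFin \o f).
Proof. by move=> [mD Dfin] bf; exact: bounded_mfun_integrable. Qed.

Lemma hintD (D : set V) (f g : V -> R) : hfinite D -> hbounded D f -> hbounded D g ->
  hint k D (fun x => f x + g x) = hint k D f + hint k D g.
Proof.
by move=> hD bf bg; apply: RintegralD; [exact: hD.1|exact: hbounded_integrable..].
Qed.

Lemma hintB (D : set V) (f g : V -> R) : hfinite D -> hbounded D f -> hbounded D g ->
  hint k D (fun x => f x - g x) = hint k D f - hint k D g.
Proof.
by move=> hD bf bg; apply: RintegralB; [exact: hD.1|exact: hbounded_integrable..].
Qed.

Lemma hintZ (D : set V) (f : V -> R) (c : R) : hfinite D -> hbounded D f ->
  hint k D (fun x => c * f x) = c * hint k D f.
Proof. by move=> hD bf; apply: RintegralZl; [exact: hD.1|exact: hbounded_integrable]. Qed.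

Lemma eq_hint (D : set V) (f g : V -> R) :
  (forall x, D x -> f x = g x) -> hint k D f = hint k D g.
Proof. by move=> fg; apply: eq_Rintegral => x /set_mem /fg. Qed.

Lemma hint0 (D : set V) : hint k D (fun=> 0) = 0 :> R.
Proof. by rewrite /hint /Rintegral integral0. Qed.

Lemma hint_set0 (f : V -> R) : hint k set0 f = 0.
Proof. exact: Rintegral_set0. Qed.

Lemma compact_closed_rV (C : set V) : compact C -> closed C.
Proof. by apply: compact_closed; exact: norm_hausdorff. Qed.

(** Compactness gives the bound. Preimages of open intervals are traces of open sets on [C], hence
    measurable because Borel sets are. *)
Lemma continuous_hbounded (C D : set V) (f : V -> R) : compact C ->
  {within C, continuous f} -> D `<=` C -> hbounded D f.
Proof.
move=> cC cf DC; have clC := compact_closed_rV cC.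
have mC : hmeasurable C by exact: closed_hausdorff_measurable.
apply: (bounded_mfunS mC DC); split; last first.
  have [M [_ fM]] := compact_bounded (continuous_compact cf cC).
  exists (M + 1) => x Cx; apply: fM; first by rewrite ltrDl.
  by exists x.
apply: (measurability _ (RGenOpens.measurableE R)).
move=> _ [_ [a [b ->] <-]].
move: (cf) => /continuousP cf'.
have /open_subspaceP[U oU UC] : open ((f : subspace C -> R) @^-1` `]a, b[).
  exact/cf'/interval_open.
rewrite setIC -UC; apply: measurableI => //.
exact: open_hausdorff_measurable.
Qed.

End hausdorff_integral.

(** * Simplices *)

Section dot_product.
Context {R : realType} {d : nat}.
Implicit Types x y z : 'rV[R]_d.

Lemma dotDr x y z : dot x (y + z) = dot x y + dot x z.
Proof. by rewrite /dot -big_split; apply: eq_bigr => k _; rewrite mxE mulrDr. Qed.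

Lemma dotZr c x y : dot x (c *: y) = c * dot x y.
Proof. by rewrite /dot mulr_sumr; apply: eq_bigr => k _; rewrite mxE mulrCA. Qed.

Lemma dotC x y : dot x y = dot y x.
Proof. by apply: eq_bigr => k _; rewrite mulrC. Qed.

Lemma dot0r x : dot x 0 = 0.
Proof. by rewrite /dot big1// => k _; rewrite mxE mulr0. Qed.

Lemma dotNr x y : dot x (- y) = - dot x y.
Proof. by rewrite -scaleN1r dotZr mulN1r. Qed.

Lemma dotDl x y z : dot (x + y) z = dot x z + dot y z.
Proof. by rewrite dotC dotDr !(dotC z). Qed.

Lemma dotZl c x y : dot (c *: x) y = c * dot x y.
Proof. by rewrite dotC dotZr dotC. Qed.

Lemma dotNl x y : dot (- x) y = - dot x y.
Proof. by rewrite dotC dotNr dotC. Qed.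

Lemma dotBl x y z : dot (x - y) z = dot x z - dot y z.
Proof. by rewrite dotDl dotNl. Qed.

Lemma dot_sumr (I : finType) x (F : I -> 'rV[R]_d) :
  dot x (\sum_i F i) = \sum_i dot x (F i).
Proof. by apply: big_morph; [exact: dotDr | exact: dot0r]. Qed.

Lemma dot_delta x k : dot x (delta_mx 0 k) = x 0 k.
Proof.
rewrite /dot (bigD1 k)//= mxE !eqxx mulr1 big1 ?addr0// => j jk.
by rewrite mxE eqxx (negbTE jk) mulr0.
Qed.

Lemma dot_eq0 x : (forall y, dot x y = 0) -> x = 0.
Proof. by move=> x0; apply/rowP => k; rewrite -dot_delta x0 mxE. Qed.

End dot_product.

Lemma continuous_sum {R : numFieldType} {T : topologicalType} {W : normedModType R}
    (I : Type) (r : seq I) (F : I -> T -> W) :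
  (forall i, continuous (F i)) -> continuous (fun t => \sum_(i <- r) F i t).
Proof.
move=> cF; elim: r => [|i r IH] t.
  by under eq_fun do rewrite big_nil; exact: cvg_cst.
by under eq_fun do rewrite big_cons; apply: continuousD; [exact: cF|exact: IH].
Qed.

(** * Convex hulls and barycentric coordinates *)

Section convex_hull.
Context {R : realType} {d n : nat} (P : 'I_n -> 'rV[R]_d).

Lemma conv_vertex (s : {set 'I_n}) j : j \in s -> Defs.conv P s (P j).
Proof.
move=> js; exists (fun i => (i == j)%:R); split.
- by move=> i; rewrite ler0n.
- by move=> i; case: eqVneq => // ->; rewrite js.
- by rewrite (bigD1 j)//= eqxx big1 ?addr0// => i /negbTE ->.
- by rewrite (bigD1 j)//= eqxx scale1r big1 ?addr0// => i /negbTE ->; rewrite scale0r.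
Qed.

(** The hull is the continuous image of a closed and bounded set of coefficient vectors. *)
Lemma conv_compact (s : {set 'I_n}) : compact (Defs.conv P s).
Proof.
pose D : set 'rV[R]_n := [set t | [/\ forall j, 0 <= t 0 j,
  forall j, j \notin s -> t 0 j = 0 & \sum_j t 0 j = 1]].
pose f (t : 'rV[R]_n) := \sum_j t 0 j *: P j.
have -> : Defs.conv P s = f @` D.
  apply/seteqP; split=> [x [t [t0 ts t1 ->]]|_ [t [t0 ts t1] <-]].
    exists (\row_j t j); last by apply: eq_bigr => j _; rewrite mxE.
    split=> [j|j|]; rewrite ?mxE//; first exact: ts.
    by rewrite -t1; apply: eq_bigr => j _; rewrite mxE.
  by exists (t 0).
have coordc j : continuous (fun t : 'rV[R]_n => t 0 j) by exact: coord_continuous.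
apply: continuous_compact.
  apply: continuous_subspaceT; apply: continuous_sum => j t.
  have H : (fun t : 'rV[R]_n => t 0 j) @ t --> t 0 j by exact: coordc.
  exact: cvgZr_tmp H.
apply: bounded_closed_compact.
  exists 1; split; first exact: num_real.
  move=> M M1 t [t0 _ t1]; apply: le_trans (ltW M1).
  rewrite [leLHS]/Num.norm/= mx_normrE; apply: bigmax_le => // -[i j] _ /=.
  rewrite ord1 ger0_norm// -t1 (bigD1 j)//= lerDl.
  by apply: sumr_ge0 => k _.
have -> : D = (\bigcap_j [set t : 'rV[R]_n | 0 <= t 0 j]) `&`
   (\bigcap_(j in [set j | j \notin s]) [set t : 'rV[R]_n | t 0 j = 0]) `&`
   [set t : 'rV[R]_n | \sum_j t 0 j = 1].
  apply/seteqP; split=> [t [t0 ts t1]|t [[t0 ts] t1]].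
    by split=> //; split=> [j _|j /= js]; [exact: t0|exact: ts].
  by split=> // j; exact: t0 j I.
apply: closedI; first apply: closedI.
- apply: closed_bigI => j _.
  apply: (@preimage_closed _ _ (fun t : 'rV[R]_n => t 0 j) [set x | 0 <= x]).
    by move=> t _; exact: coordc.
  exact: closed_ge.
- apply: closed_bigI => j _.
  apply: (@preimage_closed _ _ (fun t : 'rV[R]_n => t 0 j) [set 0]).
    by move=> t _; exact: coordc.
  exact: closed_eq.
- apply: (@preimage_closed _ _ (fun t : 'rV[R]_n => \sum_j t 0 j) [set 1]).
    by move=> t _; exact: continuous_sum.
  exact: closed_eq.
Qed.

End convex_hull.

Section affine_independence.
Context {R : realType} {d : nat} (P : 'I_d.+1 -> 'rV[R]_d).

Let E := \matrix_(j < d) (P (lift ord0 j) - P ord0).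

Hypothesis nondegenerate : row_free E.

(** The edge vectors at vertex [ord0] form a basis, and the coefficient of [ord0] makes the sum
    equal to 1. The coefficients may be negative, since [y] is any point of the space. *)
Lemma barycentric y : exists2 c : 'I_d.+1 -> R,
  \sum_j c j = 1 & y = \sum_j c j *: P j.
Proof.
have uE : E \in unitmx by rewrite -row_free_unit.
pose t := (y - P ord0) *m invmx E.
pose c j := if unlift ord0 j is Some k then t 0 k else 1 - \sum_k t 0 k.
have c0 : c ord0 = 1 - \sum_k t 0 k by rewrite /c unlift_none.
have cS k : c (lift ord0 k) = t 0 k.
  rewrite /c; case: unliftP => [k' /lift_inj -> //|/eqP].
  by rewrite eq_sym (negbTE (neq_lift _ _)).
exists c.
  by rewrite big_ord_recl c0 [X in _ + X](eq_bigr (t 0)) ?subrK.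
have yE : y - P ord0 = \sum_k t 0 k *: (P (lift ord0 k) - P ord0).
  rewrite -[LHS](mulmxKV uE) mulmx_sum_row; apply: eq_bigr => k _.
  by rewrite rowK.
rewrite -[y in LHS](subrK (P ord0)) yE.
rewrite big_ord_recl c0; under [X in _ = _ + X]eq_bigr do rewrite cS.
under [X in X + _ = _]eq_bigr do rewrite scalerBr.
by rewrite sumrB -scaler_suml scalerBl scale1r [RHS]addrC addrA [LHS]addrAC.
Qed.

Lemma orthogonal_edges y j0 : (forall j, dot y (P j - P j0) = 0) -> y = 0.
Proof.
move=> yP; apply: dot_eq0 => z.
(* Shifting by [P j0] writes an arbitrary vector [z] as a combination of the edges at [j0]. *)
have [c c1 zE] := barycentric (z + P j0).
rewrite -[z](addrK (P j0)) zE -[P j0]scale1r -c1 scaler_suml -sumrB dot_sumr.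
by rewrite big1// => j _; rewrite -scalerBr dotZr yP mulr0.
Qed.

Lemma vertex_inj : injective P.
Proof.
have uE : E \in unitmx by rewrite -row_free_unit.
have lift_neq (k : 'I_d) : P (lift ord0 k) != P ord0.
  apply/eqP => Pk; have : row k E = 0 by rewrite rowK Pk subrr.
  rewrite rowE => /(congr1 (mulmxr (invmx E))) /=.
  rewrite mul0mx mulmxK// => /rowP/(_ k); rewrite !mxE !eqxx => /eqP.
  by rewrite oner_eq0.
move=> j k; case: (unliftP ord0 j) => [j'|] ->; case: (unliftP ord0 k) => [k'|] ->//.
- move=> Pjk; congr lift; have : row j' E = row k' E by rewrite !rowK Pjk.
  rewrite !rowE => /(congr1 (mulmxr (invmx E))) /=.
  rewrite !mulmxK// => /rowP/(_ j'); rewrite !mxE !eqxx/= => /eqP.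
  by case: (j' =P k') => // _; rewrite oner_eq0.
- by move/eqP; rewrite (negbTE (lift_neq _)).
- by move/esym/eqP; rewrite (negbTE (lift_neq _)).
Qed.

End affine_independence.

(** * Adjacent simplices and their facet normals *)

Section adjacent_simplices.
Context {R : realType} {d : nat} {I : finType} (vtx : I -> 'I_d.+1 -> 'rV[R]_d).
Hypothesis nondegenerate : forall K,
  row_free (\matrix_(j < d) (vtx K (lift ord0 j) - vtx K ord0)).

(** [shared] records indices in the first simplex, so symmetry is not built in. Matching each common
    vertex with its index in [L] is injective because the vertices of [K] are distinct. *)
Lemma card_shared_le K L : (#|shared vtx K L| <= #|shared vtx L K|)%N.
Proof.
pose f j := odflt ord0 [pick l | vtx L l == vtx K j].
have fP j : j \in shared vtx K L -> vtx L (f j) = vtx K j.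
  rewrite inE => /existsP[l lj]; rewrite /f; case: pickP => [m /eqP//|/(_ l)].
  by rewrite lj.
have <- : #|f @: shared vtx K L| = #|shared vtx K L|.
  apply: card_in_imset => j j' js j's /(congr1 (vtx L)).
  by rewrite !fP// => /vertex_inj; apply.
apply: subset_leq_card; apply/fintype.subsetP => _ /imsetP[j js ->].
by rewrite inE; apply/existsP; exists j; rewrite fP.
Qed.

Lemma adj_sym K L : adj vtx K L = adj vtx L K.
Proof.
rewrite /adj eq_sym; congr (_ && (_ == _)).
by apply/eqP; rewrite eqn_leq !card_shared_le.
Qed.

Lemma shared_simplex K L j : j \in shared vtx K L ->
  (simplex vtx K `&` simplex vtx L) (vtx K j).
Proof.
move=> js; split; first by apply: conv_vertex; rewrite inE.
move: js; rewrite inE => /existsP[l /eqP <-].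
by apply: conv_vertex; rewrite inE.
Qed.

Lemma unshared_vertex K L : adj vtx K L -> exists p, forall j,
  (j \in shared vtx K L) = (j != p).
Proof.
case/andP=> _ /eqP cs.
have : #|~: shared vtx K L|%SET == 1%N.
  by rewrite -(eqn_add2l d) -{1}cs cardsC card_ord addn1.
move=> /cards1P[p pE]; exists p => j.
by have /setP/(_ j) := pE; rewrite !inE => <-; rewrite negbK.
Qed.

(* If the two opposite vertices were on the same side of the common facet, a
   point near its barycenter in the interior of [K] would lie in both simplices,
   hence on the facet. *)
Lemma opposite_vertex_side K L nu p j0 q : (0 < d)%N -> adj vtx K L ->
  facet_normal vtx K L nu ->
  (forall j, (j \in shared vtx K L) = (j != p)) -> j0 != p ->
  0 <= dot nu (vtx L q - vtx K j0).
Proof.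
move=> d0 aKL [nu1 nuF nuK] sE j0p.
set q' := vtx L q.
have j0s : j0 \in shared vtx K L by rewrite sE.
have nuS j : j != p -> dot nu (vtx K j - vtx K j0) = 0.
  move=> jp; apply: nuF; first exact: shared_simplex.
  by apply: shared_simplex; rewrite sE.
(* [al] is the signed height of the opposite vertex of [K] over the common facet; the height of any
   affine combination of vertices is [al] times its coefficient at [p]. *)
pose al := dot nu (vtx K p - vtx K j0).
have al0 : al <= 0.
  by apply: nuK; [exact: shared_simplex|apply: conv_vertex; rewrite inE].
have [c c1 qE] := barycentric (nondegenerate K) q'.
have nuq (t : 'I_d.+1 -> R) : \sum_j t j = 1 ->
    dot nu ((\sum_j t j *: vtx K j) - vtx K j0) = t p * al.
  move=> t1; rewrite -[vtx K j0 in LHS]scale1r -t1 scaler_suml -sumrB dot_sumr.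
  rewrite (bigD1 p)//= -scalerBr dotZr big1 ?addr0// => j jp.
  by rewrite -scalerBr dotZr nuS// mulr0.
rewrite qE nuq//.
have [cp|cp] := leP (c p) 0; first by rewrite mulr_le0.
have [->|al_neq0] := eqVneq al 0; first by rewrite mulr0.
exfalso; move/eqP: al_neq0; apply.
(* [e] is chosen so that [(1 - e) / n = e * C]: moving from the facet barycenter towards [q'] by the
   fraction [e] keeps every coefficient on the facet nonnegative, since [- c j <= C]. *)
pose n : R := d%:R; pose C := \sum_j `|c j|; pose e := (1 + n * C)^-1.
have n0 : 0 < n by rewrite ltr0n.
have C0 : 0 <= C by exact: sumr_ge0.
have e0 : 0 < e by rewrite invr_gt0 ltr_wpDr// mulr_ge0// ltW.
have eE : 1 - e = e * (n * C).
  by rewrite /e; field; rewrite gt_eqF// ltr_wpDr// mulr_ge0// ltW.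
have cC j : - c j <= C.
  apply: (@le_trans _ _ `|c j|); first by rewrite -normrN ler_norm.
  by rewrite /C (bigD1 j)//= lerDl sumr_ge0.
pose w j : R := if j == p then 0 else n^-1.
have w0 j : 0 <= w j by rewrite /w; case: eqP => // _; rewrite invr_ge0 ltW.
have w1 : \sum_j w j = 1.
  rewrite (bigD1 p)//= /w eqxx add0r.
  rewrite (eq_bigr (fun=> n^-1)); last by move=> j /negbTE ->.
  rewrite sumr_const (_ : #|_| = d) ?mulr_natr; last first.
    by rewrite cardC1 card_ord.
  by rewrite -mulr_natr mulVf// gt_eqF.
pose t j := (1 - e) * w j + e * c j.
have t1 : \sum_j t j = 1.
  by rewrite big_split/= -!mulr_sumr w1 c1 !mulr1 subrK.
have tp : t p = e * c p by rewrite /t /w eqxx mulr0 add0r.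
have t0 j : 0 <= t j.
  have [->|jp] := eqVneq j p; first by rewrite tp mulr_ge0// ltW.
  rewrite /t /w (negbTE jp) eE [n * C]mulrC mulrA mulfK ?gt_eqF//.
  by rewrite -mulrDr; apply: mulr_ge0; [exact: ltW | rewrite -lerBlDr sub0r cC].
have yK : simplex vtx K (\sum_j t j *: vtx K j).
  by exists t; split => // j; rewrite inE.
have yL : simplex vtx L (\sum_j t j *: vtx K j).
  have Lconv x y a : simplex vtx L x -> simplex vtx L y -> 0 <= a <= 1 ->
      simplex vtx L ((1 - a) *: x + a *: y).
    move=> [s [s0 _ s1 ->]] [s' [s0' _ s1' ->]] /andP[a0 a1].
    exists (fun j => (1 - a) * s j + a * s' j); split.
    - by move=> j; rewrite addr_ge0 ?mulr_ge0// subr_ge0.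
    - by move=> j; rewrite inE.
    - by rewrite big_split/= -!mulr_sumr s1 s1' !mulr1 subrK.
    - rewrite !scaler_sumr -big_split; apply: eq_bigr => j _.
      by rewrite /= !scalerA -scalerDl.
  have -> : \sum_j t j *: vtx K j =
      (1 - e) *: (\sum_j w j *: vtx K j) + e *: q'.
    rewrite qE !scaler_sumr -big_split; apply: eq_bigr => j _.
    by rewrite /= !scalerA -scalerDl.
  apply: Lconv; [|by apply: conv_vertex; rewrite inE|].
    have lP j : exists l, j != p -> vtx L l = vtx K j.
      have [->|jp] := eqVneq j p; first by exists ord0.
      have : j \in shared vtx K L by rewrite sE.
      by rewrite inE => /existsP[l /eqP ?]; exists l.
    have [g gP] := choice lP.
    (* The weights of the facet barycenter are transported to the matching vertices of [L]; the
       arbitrary image of [p] does no harm because [w p] is 0. *)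
    exists (fun l => \sum_(j | g j == l) w j); split.
    - by move=> l; exact: sumr_ge0.
    - by move=> l; rewrite inE.
    - by rewrite -[RHS]w1 [RHS](partition_big g xpredT)//=.
    - rewrite (partition_big g xpredT)//=; apply: eq_bigr => l _.
      rewrite scaler_suml; apply: eq_bigr => j /eqP <-.
      by have [->|jp] := eqVneq j p; [rewrite /w eqxx !scale0r | rewrite gP].
  have nC0 : 0 <= n * C by rewrite mulr_ge0// ltW.
  by rewrite ltW//= invf_le1 ?lerDl// ltr_wpDr.
(* The constructed point lies in both simplices, so its height [e * c p * al] is zero, which forces
   [al = 0]. *)
have /eqP := nuF _ _ (shared_simplex j0s) (conj yK yL).
rewrite nuq// tp !mulf_eq0 (gt_eqF e0) (gt_eqF cp)/=.
by move=> /eqP.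
Qed.

(** Both normals are orthogonal to the common facet, hence parallel, and being unit vectors they
    agree up to sign. If they were equal, all of [L] would lie in the facet hyperplane, against
    nondegeneracy. *)
Lemma facet_normal_opp K L a b : (1 < d)%N -> adj vtx K L ->
  facet_normal vtx K L a -> facet_normal vtx L K b -> b = - a.
Proof.
move=> d1 aKL na nb.
have aLK : adj vtx L K by rewrite adj_sym.
have [p sE] := unshared_vertex aKL.
have [j0 j0s] : exists j, j \in shared vtx K L.
  by case/andP: aKL => _ /eqP cs; apply/card_gt0P; rewrite cs ltnW.
have j0p : j0 != p by rewrite -sE.
have side q : 0 <= dot a (vtx L q - vtx K j0).
  exact: (opposite_vertex_side _ (ltnW d1) aKL na sE j0p).
case: na => a1 aF aK; case: nb => b1 bF bL.
have setIKL := setIC (simplex vtx L) (simplex vtx K).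
have inKL j : j != p -> (simplex vtx K `&` simplex vtx L) (vtx K j).
  by move=> jp; apply: shared_simplex; rewrite sE.
have aS j : j != p -> dot a (vtx K j - vtx K j0) = 0.
  by move=> jp; apply: aF; exact: inKL.
have bS j : j != p -> dot b (vtx K j - vtx K j0) = 0.
  by move=> jp; apply: bF; rewrite setIKL; exact: inKL.
have norm1_neq0 (x : 'rV[R]_d) : dot x x = 1 -> x != 0.
  by move=> x1; apply/eqP => x0; move/eqP: x1; rewrite x0 dot0r eq_sym oner_eq0.
pose al := dot a (vtx K p - vtx K j0).
have al0 : al != 0.
  apply/eqP => al0; have /eqP := norm1_neq0 a a1; apply.
  apply: (orthogonal_edges (nondegenerate K) (j0 := j0)) => j.
  by have [->//|/aS] := eqVneq j p.
(* With this ratio [b - r *: a] is orthogonal to the edge towards [p] as well, hence to all edges of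
   [K]. *)
pose r := dot b (vtx K p - vtx K j0) / al.
have bE : b = r *: a.
  apply/eqP; rewrite -subr_eq0; apply/eqP.
  apply: (orthogonal_edges (nondegenerate K) (j0 := j0)) => j.
  rewrite dotBl dotZl; have [->|jp] := eqVneq j p; last by rewrite aS ?bS// mulr0 subrr.
  by rewrite -/al divfK// subrr.
have : (r - 1) * (r + 1) = 0.
  by rewrite -subr_sqr expr1n -b1 bE dotZl dotZr a1 mulr1 -expr2 subrr.
move=> /eqP; rewrite mulf_eq0 subr_eq0 addr_eq0 => /orP[/eqP r1|/eqP r1]; last first.
  by rewrite bE r1 scaleN1r.
have ba : b = a by rewrite bE r1 scale1r.
have [l lE] : exists l, vtx L l = vtx K j0.
  by move: j0s; rewrite inE => /existsP[l /eqP]; exists l.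
exfalso; have /eqP := norm1_neq0 b b1; apply.
apply: (orthogonal_edges (nondegenerate L) (j0 := l)) => q.
(* The lower bound on the height comes from [a], for which [L] is on the outer side, the upper bound
   from [b] as exterior normal of [L]. *)
apply/eqP; rewrite eq_le lE {2}ba side andbT.
apply: bL; first by rewrite setIKL; exact: inKL.
by apply: conv_vertex; rewrite inE.
Qed.

End adjacent_simplices.

(** * Smooth fields times affine functions *)

Lemma near_eq_continuous {T U : topologicalType} (f g : T -> U) (x : T) :
  {near x, f =1 g} -> {for x, continuous f} -> {for x, continuous g}.
Proof.
move=> fg cf; rewrite /prop_for /continuous_at -(nbhs_singleton fg).
by apply: cvg_trans cf; exact: near_eq_cvg.
Qed.

Section affine_functions.
Context {R : realType} {d : nat}.
Local Notation V := 'rV[R]_d.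
Implicit Types (p : P1 R d) (U : set V) (f g : V -> R).

Lemma dot_continuous (y : V) : continuous (dot y).
Proof.
have cF (k : 'I_d) : continuous (fun x : V => y 0 k * x 0 k).
  move=> x.
  apply: (@continuousM R V (fun=> y 0 k) (fun x => x 0 k)).
    exact: cst_continuous.
  exact: (@coord_continuous R 1 d 0 k x).
exact: (@continuous_sum R V R^o _ _ _ cF).
Qed.

Lemma ev_continuous p : continuous (ev p).
Proof.
move=> x; apply: (@continuousD _ _ _ (fun=> p.1) (dot p.2)); first exact: cst_continuous.
exact: dot_continuous.
Qed.

Lemma is_derive_ev p x v : is_derive x v (ev p) (dot p.2 v).
Proof.
have lim : (fun h => h^-1 *: ((ev p \o shift x) (h *: v) - ev p x)) @ 0^' -->
    dot p.2 v.
  apply: (@cvg_trans _ ((fun _ : R => dot p.2 v) @ 0^')); last exact: cvg_cst.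
  apply: near_eq_cvg; near=> h.
  have h0 : h != 0 by near: h; exact: nbhs_dnbhs_neq.
  rewrite /ev /= dotDr dotZr addrCA addrK.
  by rewrite /GRing.scale/= mulKf.
by apply: DeriveDef; [apply/cvg_ex; exists (dot p.2 v)|exact: cvg_lim lim].
Unshelve. all: by end_near.
Qed.

(** On an open set, equality at a point holds on a neighborhood, so continuity and partial
    derivatives carry over at every order. *)
Lemma class_C_ext n U f g : open U -> (forall x, U x -> f x = g x) ->
  class_C n U f -> class_C n U g.
Proof.
move=> oU; have nearU x : U x -> \forall y \near x, U y.
  by move=> Ux; move: oU; rewrite openE => /(_ x Ux).
have cont f' g' : (forall x, U x -> f' x = g' x) ->
    (forall x, U x -> {for x, continuous f'}) ->
    forall x, U x -> {for x, continuous g'}.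
  move=> fg cf x Ux; apply: near_eq_continuous (cf x Ux).
  by apply: (filterS _ (nearU x Ux)) => y /fg.
elim: n f g => [|n IH] f g fg /= [cf]; first by split=> //; exact: cont fg cf.
move=> df; split; first exact: cont fg cf.
move=> l; have [dfl Cfl] := df l.
have fgn x : U x -> {near x, f =1 g}.
  by move=> Ux; apply: (filterS _ (nearU x Ux)) => y /fg.
split=> [x Ux|]; first by apply: near_eq_derivable (dfl x Ux); exact: fgn.
apply: IH Cfl => x Ux; apply: near_eq_derive => //; exact: fgn.
Qed.

Lemma class_C_lower n U f : class_C n.+1 U f -> class_C n U f.
Proof.
elim: n f => [|n IH] f; first by case.
by move=> [cf df]; split=> // l; have [? /IH] := df l.
Qed.

Lemma class_CD n U f g : open U -> class_C n U f -> class_C n U g ->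
  class_C n U (f + g).
Proof.
move=> oU; elim: n f g => [|n IH] f g /= [cf df] [cg dg].
  by split=> // x Ux; apply: continuousD; [exact: cf|exact: cg].
split=> [x Ux|l]; first by apply: continuousD; [exact: cf|exact: cg].
have [dfl Cfl] := df l; have [dgl Cgl] := dg l.
split=> [x Ux|]; first by apply: derivableD; [exact: dfl|exact: dgl].
apply: class_C_ext (IH _ _ Cfl Cgl) => // x Ux.
by rewrite /partial deriveD//; [exact: dfl|exact: dgl].
Qed.

Lemma partial_evM p l f x : derivable f x (delta_mx 0 l) ->
  partial l (fun y => ev p y * f y) x = ev p x * partial l f x + p.2 0 l * f x.
Proof.
move=> df; rewrite /partial (_ : (fun y => _) = ev p * f)//.
have [dp dpE] := is_derive_ev p x (delta_mx 0 l).
by rewrite (deriveM dp df) dpE dot_delta /GRing.scale/= [f x * _]mulrC.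
Qed.

Lemma class_C_evM n U p f : open U -> class_C n U f ->
  class_C n U (fun x => ev p x * f x).
Proof.
move=> oU; elim: n p f => [|n IH] p f Cf.
  case: Cf => cf _; split=> // x Ux.
  by apply: continuousM; [exact: ev_continuous|exact: cf].
have [cf df] := Cf; split=> [x Ux|l].
  by apply: continuousM; [exact: ev_continuous|exact: cf].
have [dfl Cfl] := df l.
split=> [x Ux|].
  have [dp dpE] := is_derive_ev p x (delta_mx 0 l).
  exact: (derivableM dp (dfl x Ux)).
(* By Leibniz' rule the derivative is again a sum of products of an affine function with a function
   of one class lower; the constant slope counts as the affine function [(p.2 0 l, 0)]. *)
apply: class_C_ext (class_CD oU (IH p _ Cfl) (IH (p.2 0 l, 0) _ (class_C_lower Cf))).
  by [].
move=> x Ux; rewrite partial_evM; last exact: dfl.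
by congr (_ + _ * _); rewrite /ev /= dotC dot0r addr0.
Qed.

Lemma smooth_field_evM (S : set V) p (X : V -> V) : smooth_field S X ->
  smooth_field S (fun x => ev p x *: X x).
Proof.
move=> sX k; have [U [oU SU CU]] := sX k; exists U; split=> // n.
by under eq_fun do rewrite mxE; exact: class_C_evM.
Qed.

Lemma smooth_on_continuous (S : set V) f : smooth_on S f -> {in S, continuous f}.
Proof. by move=> [U [oU SU CU]] x /set_mem /SU Ux; have [cf _] := CU 0%N; exact: cf. Qed.

Lemma smooth_on_derivable (S : set V) f x l : smooth_on S f -> S x ->
  derivable f x (delta_mx 0 l).
Proof.
by move=> [U [oU SU CU]] /SU Ux; have [_ /(_ l)[df _]] := CU 1%N; exact: df.
Qed.

End affine_functions.

Section divergence.
Context {R : realType} {d : nat} (G : geometry R d).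
Local Notation V := 'rV[R]_d.

Lemma tprojD i x (v w : V) : tproj G i x (v + w) = tproj G i x v + tproj G i x w.
Proof.
rewrite /tproj; case: ifP => // _.
by rewrite dotDr scalerDl opprD addrACA.
Qed.

Lemma tprojZ i x c (v : V) : tproj G i x (c *: v) = c *: tproj G i x v.
Proof. by rewrite /tproj; case: ifP => // _; rewrite dotZr scalerBr scalerA. Qed.

Lemma tproj0 i x : tproj G i x 0 = 0.
Proof. by rewrite -[0 in LHS](scale0r 0) tprojZ scale0r. Qed.

Lemma tprojN i x (v : V) : tproj G i x (- v) = - tproj G i x v.
Proof. by rewrite -scaleN1r tprojZ scaleN1r. Qed.

(** Product rule for the field to which Gauss' theorem is applied; the projection is self-evidently
    linear, so it passes through the Leibniz sum for each component. *)
Lemma divi_evM i (p : P1 R d) (X : V -> V) x : smooth_field (closure (Om G i)) X ->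
  Om G i x -> divi G i (fun y => ev p y *: X y) x =
  ev p x * divi G i X x + dot (X x) (tproj G i x p.2).
Proof.
move=> sX Ox; rewrite /divi /dot mulr_sumr -big_split; apply: eq_bigr => k _ /=.
have -> : grad (fun y => (ev p y *: X y) 0 k) x =
    ev p x *: grad (fun y => X y 0 k) x + X x 0 k *: p.2.
  apply/rowP => l; rewrite !mxE.
  under [in LHS]eq_fun do rewrite mxE.
  rewrite partial_evM 1?[p.2 _ _ * _]mulrC//.
  by apply: smooth_on_derivable (sX k) _; exact: subset_closure.
by rewrite tprojD !tprojZ !mxE.
Qed.

Lemma tangential_evM i (p : P1 R d) (X : V -> V) : tangential G i X ->
  tangential G i (fun x => ev p x *: X x).
Proof.
rewrite /tangential; case: ifP => _ tX.
  by move=> x Ox; rewrite dotZr tX// mulr0.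
by move=> x nu bx xnu; rewrite dotZr tX// mulr0.
Qed.

End divergence.

(** * Boundedness of the integrands *)

Lemma within_continuous_comp {T U W : topologicalType} (A : set T)
    (f : T -> U) (g : U -> W) :
  {within A, continuous f} -> continuous g -> {within A, continuous (g \o f)}.
Proof.
move=> cf cg x; apply: (@continuous_comp (subspace A) U W f g x).
  exact: cf.
exact: cg.
Qed.

Section bounded_vector_fields.
Context {R : realType} {d : nat} (k : nat) (D : set 'rV[R]_d).
Local Notation V := 'rV[R]_d.
Implicit Types (X Y : V -> V) (f : V -> R).

Definition hbounded_field X : Prop := forall j, hbounded k D (fun x => X x 0 j).

Lemma hbounded_field_cst c : hbounded_field (fun=> c).
Proof. by move=> j; exact: hbounded_cst. Qed.

Lemma hbounded_dot X Y : hbounded_field X -> hbounded_field Y ->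
  hbounded k D (fun x => dot (X x) (Y x)).
Proof. by move=> bX bY; apply: hbounded_sum => j; exact: hboundedM. Qed.

Lemma hbounded_fieldZ f X : hbounded k D f -> hbounded_field X ->
  hbounded_field (fun x => f x *: X x).
Proof.
move=> bf bX j.
have -> : (fun x => (f x *: X x) 0 j) = (fun x => f x * X x 0 j).
  by apply/funext => x; rewrite mxE.
by apply: hboundedM.
Qed.

Lemma hbounded_fieldB X Y : hbounded_field X -> hbounded_field Y ->
  hbounded_field (fun x => X x - Y x).
Proof.
move=> bX bY j.
have -> : (fun x => (X x - Y x) 0 j) = (fun x => X x 0 j - Y x 0 j).
  by apply/funext => x; rewrite !mxE.
by apply: hboundedB.
Qed.

Lemma hbounded_field_mulmx X (A : V -> 'M[R]_d) : hbounded_field X ->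
  (forall j l, hbounded k D (fun x => A x j l)) ->
  hbounded_field (fun x => X x *m (A x)^T).
Proof.
move=> bX bA j.
have -> : (fun x => (X x *m (A x)^T) 0 j) = (fun x => \sum_l X x 0 l * A x j l).
  by apply/funext => x; rewrite mxE; apply: eq_bigr => l _; rewrite mxE.
by apply: hbounded_sum => l; apply: hboundedM.
Qed.

(** The co-normals have this form. A normalized coordinate is at most 1 in absolute value without
    any lower bound on the length of [X]. *)
Lemma hbounded_normalize X : hbounded_field X ->
  hbounded_field (fun x => (enorm (X x))^-1 *: X x).
Proof.
move=> bX j.
have -> : (fun x => ((enorm (X x))^-1 *: X x) 0 j) =
    (fun x => (enorm (X x))^-1 * X x 0 j) by apply/funext => x; rewrite mxE.
split.
  apply: measurable_funM; last exact: (bX j).1.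
  apply: measurable_fun_inv => [|x _]; last exact: sqrtr_ge0.
  apply: (measurableT_comp (f := @Num.sqrt R)).
    by apply: continuous_measurable_fun; exact: sqrt_continuous.
  exact: (hbounded_dot bX bX).1.
exists 1 => x _; rewrite normrM normfV.
(* Where [X] vanishes, the convention that the inverse of 0 is 0 makes the normalized vector
   zero. *)
have [->|X0] := eqVneq (enorm (X x)) 0; first by rewrite normr0 invr0 mul0r.
rewrite mulrC ler_pdivrMr ?normr_gt0// mul1r [leRHS]ger0_norm ?sqrtr_ge0//.
exact: coord_le_enorm.
Qed.

End bounded_vector_fields.

(** * Cut elements and cut faces: measurability, finiteness, boundedness *)

Section cut_sets.
Context {R : realType} {d : nat} {G : geometry R d} (T : mesh G).
Local Notation V := 'rV[R]_d.
Local Notation cut i K := (Defs.cut G (@vtx _ _ _ T) i K).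
Local Notation cut_face i K L := (Defs.cut_face G (@vtx _ _ _ T) i K L).
Local Notation simplex K := (Defs.simplex (@vtx _ _ _ T) K).
Local Notation adj := (Defs.adj (@vtx _ _ _ T)).
Implicit Types (i : 'I_3) (K L : cell T).

Lemma simplex_closed K : closed (simplex K).
Proof. by apply: compact_closed_rV; exact: conv_compact. Qed.

Lemma hmeasurable_Om k i : hmeasurable k (Om G i).
Proof.
have [->|i0'] := eqVneq i i0.
  apply: closed_hausdorff_measurable; apply: compact_closed_rV.
  exact: (@geo_compact _ _ G).
by apply: open_hausdorff_measurable; case: (geo_open G i0').
Qed.

Lemma hmeasurable_cut k i K : hmeasurable k (cut i K).
Proof.
apply: measurableI; last exact: hmeasurable_Om.
by apply: closed_hausdorff_measurable; exact: simplex_closed.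
Qed.

Lemma hmeasurable_cut_face k i K L : hmeasurable k (cut_face i K L).
Proof.
apply: measurableI; last exact: hmeasurable_Om.
by apply: measurableI; apply: closed_hausdorff_measurable; exact: simplex_closed.
Qed.

Lemma cut_eq0 i K : K \notin Th T i -> cut i K = set0.
Proof.
move=> nK; apply/seteqP; split=> // x xK; move/negP: nK; apply.
by rewrite inE; apply/asboolP; exists x.
Qed.

Lemma cut_face_sub i K L : cut_face i K L `<=` cut i K.
Proof. by move=> x [[]]. Qed.

Lemma cut_faceC i K L : cut_face i K L = cut_face i L K.
Proof. by rewrite /Defs.cut_face [simplex K `&` _]setIC. Qed.

Lemma cut_face_eq0 i K L : K \notin Th T i -> cut_face i K L = set0.
Proof. by move=> /cut_eq0 K0; rewrite -subset0 -K0; exact: cut_face_sub. Qed.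

Lemma hfinite_cut i K : hfinite (dim_of d i) (cut i K).
Proof.
split; first exact: hmeasurable_cut.
have [KT|/cut_eq0 ->] := boolP (K \in Th T i).
  by have [] := mesh_green KT.
by rewrite hausdorff0.
Qed.

Lemma hfinite_cut_face i K L : adj K L -> hfinite (dim_of d i).-1 (cut_face i K L).
Proof.
move=> aKL; split; first exact: hmeasurable_cut_face.
have [KT|/cut_face_eq0 ->] := boolP (K \in Th T i).
  by have [_ + _] := mesh_green KT; exact.
by rewrite hausdorff0.
Qed.

(** A cut element need not be closed, but it sits in the compact intersection of its simplex with
    the closure of the subdomain. *)
Lemma hbounded_within k i K (D : set V) (f : V -> R) : D `<=` cut i K ->
  {within closure (Om G i), continuous f} -> hbounded k D f.
Proof.
move=> DK cf.
apply: (@continuous_hbounded _ _ k (simplex K `&` closure (Om G i))).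
- apply: compact_closedI; first exact: conv_compact.
  exact: closed_closure.
- by apply: continuous_subspaceW cf => x [].
- by move=> x /DK [Kx Ox]; split=> //; exact: subset_closure.
Qed.

Lemma hbounded_smooth k i K (D : set V) (f : V -> R) : D `<=` cut i K ->
  smooth_on (closure (Om G i)) f -> hbounded k D f.
Proof.
move=> DK sf; apply: hbounded_within DK _; apply: continuous_in_subspaceT.
exact: smooth_on_continuous.
Qed.

Lemma hbounded_ev k i K (D : set V) p : D `<=` cut i K -> hbounded k D (ev p).
Proof.
move=> DK; apply: hbounded_within DK _; apply: continuous_subspaceT.
exact: ev_continuous.
Qed.

Lemma hbounded_n0 k K (D : set V) : D `<=` cut i0 K ->
  hbounded_field k D (n0 G).
Proof.
move=> DK j; apply: hbounded_within DK _.
have clO : closure (Om G i0) = Om G i0.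
  apply/esym/closure_id; apply: compact_closed_rV; exact: (@geo_compact _ _ G).
rewrite clO; apply: (within_continuous_comp (g := fun v : V => v 0 j)).
  exact: n0_continuous.
exact: coord_continuous.
Qed.

Lemma hbounded_tproj k i K (D : set V) (c : V) : D `<=` cut i K ->
  hbounded_field k D (fun x => tproj G i x c).
Proof.
rewrite /tproj; case: eqP => [->|_] DK; last exact: hbounded_field_cst.
have bn := hbounded_n0 k DK.
apply: hbounded_fieldB; first exact: hbounded_field_cst.
apply: (hbounded_fieldZ _ bn).
by apply: (hbounded_dot bn); exact: hbounded_field_cst.
Qed.

End cut_sets.

Section bounded_integrands.
Context {R : realType} {d : nat} {G : geometry R d} {T : mesh G}.
Context (P : problem G) (S : discretization T).
Context (k : nat) (i : 'I_3) (D : set 'rV[R]_d).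
Context (K0 : cell T) (DK : D `<=` Defs.cut G (@vtx _ _ _ T) i K0).
Implicit Types (v : cell T -> P1 R d) (K L : cell T).

Lemma hbounded_beta : hbounded_field k D (beta P i).
Proof. by move=> j; apply: hbounded_smooth DK _; exact: beta_smooth. Qed.

Lemma hbounded_conu K L : hbounded_field k D (conu i K L).
Proof. by apply: hbounded_normalize; exact: hbounded_tproj DK. Qed.

Lemma hbounded_diffusion j l : hbounded k D (fun x => diffusion P i x j l).
Proof. by apply: hbounded_smooth DK _; exact: diffusion_smooth. Qed.

Lemma hbounded_nab v K : hbounded_field k D (nab i v K).
Proof. exact: hbounded_tproj DK. Qed.

Lemma hbounded_Anab v K : hbounded_field k D (Anab P i v K).
Proof.
by apply: hbounded_field_mulmx; [exact: hbounded_nab|exact: hbounded_diffusion].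
Qed.

Lemma hbounded_jump v K L : hbounded k D (jump v K L).
Proof. by apply: hboundedB; exact: hbounded_ev DK. Qed.

Lemma hbounded_avg v K L : hbounded k D (avg S v K L).
Proof.
by apply: hboundedD; apply: hboundedM;
  [exact: hbounded_cst|exact: hbounded_ev DK
  |exact: hbounded_cst|exact: hbounded_ev DK].
Qed.

Lemma hbounded_avg_flux v K L : hbounded k D (avg_flux P S i v K L).
Proof.
apply: hboundedB; apply: hboundedM.
- exact: hbounded_cst.
- by apply: hbounded_dot; [exact: hbounded_conu|exact: hbounded_Anab].
- exact: hbounded_cst.
- by apply: hbounded_dot; [exact: hbounded_conu|exact: hbounded_Anab].
Qed.

Lemma hbounded_nu_beta K L : hbounded k D (nu_beta P i K L).
Proof. by apply: hbounded_dot; [exact: hbounded_conu|exact: hbounded_beta]. Qed.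

Lemma hbounded_lambda_a K L : hbounded k D (lambda_a P S i K L).
Proof.
apply: hboundedM; first exact: hbounded_cst.
apply: hbounded_dot; first exact: hbounded_conu.
by apply: hbounded_field_mulmx; [exact: hbounded_conu|exact: hbounded_diffusion].
Qed.

Lemma hbounded_lambda_b K L : hbounded k D (lambda_b P S i K L).
Proof.
apply: hboundedM; first exact: hbounded_cst.
by apply: hbounded_norm; exact: hbounded_nu_beta.
Qed.

End bounded_integrands.

(** * Faces *)

Section face_orientation.
Context {R : realType} {d : nat} {G : geometry R d} {T : mesh G}.
Context (P : problem G) (S : discretization T).
Local Notation adj := (Defs.adj (@vtx _ _ _ T)).
Implicit Types (i : 'I_3) (v : cell T -> P1 R d) (K L : cell T).

Lemma mesh_adj_sym K L : adj K L = adj L K.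
Proof. exact: (adj_sym (@mesh_nondegenerate _ _ _ T)). Qed.

Lemma nrm_opp K L : adj K L -> nrm L K = - nrm K L.
Proof.
move=> aKL; apply: (facet_normal_opp (@mesh_nondegenerate _ _ _ T) _ aKL).
- by case/orP: (geo_dim G) => /eqP ->.
- exact: nrm_normal.
- by apply: nrm_normal; rewrite mesh_adj_sym.
Qed.

Lemma conu_opp i K L x : adj K L -> conu i L K x = - conu i K L x.
Proof.
move=> aKL; rewrite /conu /conormal (nrm_opp aKL) tprojN scalerN; congr (- (_ *: _)).
by congr (_^-1); rewrite /enorm dotNl dotNr opprK.
Qed.

Lemma nu_beta_opp i K L x : adj K L -> nu_beta P i L K x = - nu_beta P i K L x.
Proof. by move=> aKL; rewrite /nu_beta conu_opp// dotNl. Qed.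

Lemma lambda_a_sym i K L x : adj K L -> lambda_a P S i L K x = lambda_a P S i K L x.
Proof. by move=> aKL; rewrite /lambda_a conu_opp// mulNmx dotNl dotNr opprK. Qed.

Lemma lambda_b_sym i K L x : adj K L -> lambda_b P S i L K x = lambda_b P S i K L x.
Proof. by move=> aKL; rewrite /lambda_b nu_beta_opp// normrN. Qed.

Lemma jump_opp v K L x : jump v L K x = - jump v K L x.
Proof. by rewrite /jump opprB. Qed.

Lemma avg_sym v K L x : avg S v L K x = avg S v K L x.
Proof. by rewrite /avg addrC. Qed.

Lemma avg_flux_opp i v K L x : avg_flux P S i v L K x = - avg_flux P S i v K L x.
Proof. by rewrite /avg_flux opprB. Qed.

(** Each term of the flux pairs an odd factor with even ones: the averaged flux, the jump and the
    normal component of beta change sign, the penalties and the average do not. *)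
Lemma Sigma_n_opp i v K L x : adj K L ->
  Sigma_n P S i v L K x = - Sigma_n P S i v K L x.
Proof.
move=> aKL; rewrite /Sigma_n avg_flux_opp lambda_a_sym// lambda_b_sym// jump_opp.
by rewrite nu_beta_opp// avg_sym; ring.
Qed.

(** Since the two weights sum to 1, [theta - 2^-1] is odd like the other two factors, and three sign
    changes leave one. *)
Lemma weight_defect_opp i v K L x : adj K L ->
  weight_defect P S i v L K x = - weight_defect P S i v K L x.
Proof.
move=> aKL; rewrite /weight_defect nu_beta_opp// jump_opp.
by rewrite -(addKr (theta S K L) (theta S L K)) theta_sum//; field.
Qed.

End face_orientation.

(** * Rearranging sums over elements and faces *)

Section face_sums.
Context {R : realType} {d : nat} {G : geometry R d} {T : mesh G}.
Local Notation adj := (Defs.adj (@vtx _ _ _ T)).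
Implicit Types (D M : {set cell T}) (Q : cell T -> cell T -> R).

Lemma sum_adj_faces D Q :
  \sum_(K in D) \sum_(L in D | adj K L) Q K L =
  \sum_(p in faces D) (Q p.1 p.2 + Q p.2 p.1).
Proof.
rewrite pair_big_dep/= (bigID (fun p => ordered p.1 p.2))/= big_split/=.
congr (_ + _); first by apply: eq_bigl => p; rewrite inE -!andbA.
(* Every face occurs as two pairs, exactly one of them [ordered]; swapping turns the other half into
   a sum over the same faces. *)
rewrite (reindex_inj (h := fun p : cell T * cell T => (p.2, p.1)))/=; last first.
  by move=> [a b] [a' b'] [-> ->].
apply: eq_bigl => -[K L] /=; rewrite inE/= mesh_adj_sym.
have [aKL|] := boolP (adj K L); last by rewrite !andbF.
by rewrite (ordered_enum aKL); case: (K \in D); case: (L \in D); case: (ordered L K).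
Qed.

Lemma sum_indicator (I : finType) (A M : {set I}) (F : I -> R) : M \subset A ->
  \sum_(K in A) (K \in M)%:R * F K = \sum_(K in M) F K.
Proof.
move=> /fintype.subsetP MA; rewrite [RHS]big_mkcond [LHS]big_mkcond.
apply: eq_bigr => K _; case: (boolP (K \in M)) => [/MA ->|_]; first by rewrite mul1r.
by rewrite mul0r; case: ifP.
Qed.

(** The coefficient selects the faces with exactly one side in [M], and oddness of [Q] lets each of
    them be read with its first element in [M]. *)
Lemma sum_faces_boundary i M Q : M \subset Th T i ->
  (forall K L, adj K L -> Q L K = - Q K L) ->
  \sum_(p in faces (Th T i)) ((p.1 \in M)%:R - (p.2 \in M)%:R) * Q p.1 p.2 =
  \sum_(p in boundary_faces i M) Q p.1 p.2.
Proof.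
move=> MT Qopp.
transitivity (\sum_(p in faces (Th T i))
    ((p.1 \in M)%:R * Q p.1 p.2 + (p.2 \in M)%:R * Q p.2 p.1)).
  apply: eq_bigr => p; rewrite inE => /and4P[_ _ a _].
  by rewrite (Qopp _ _ a); ring.
rewrite -(sum_adj_faces _ (fun K L => (K \in M)%:R * Q K L)).
under eq_bigr do rewrite -mulr_sumr.
rewrite sum_indicator//.
under eq_bigr do rewrite (bigID (fun L => L \in M))/=.
(* Faces interior to [M] are seen from both sides and cancel by oddness. *)
rewrite big_split/= [X in X + _](_ : _ = 0) ?add0r; last first.
  transitivity (\sum_(K in M) \sum_(L in M | adj K L) Q K L).
    apply: eq_bigr => K _; apply: eq_bigl => L.
    case: (boolP (L \in M)) => [/(fintype.subsetP MT) ->|]; first by rewrite andbT.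
    by rewrite andbF.
  rewrite sum_adj_faces big1// => p; rewrite inE => /and4P[_ _ a _].
  by rewrite (Qopp _ _ a) subrr.
rewrite pair_big_dep/=; apply: eq_bigl => p; rewrite [RHS]inE.
by rewrite -[in LHS](andbA (p.2 \in _)) [adj _ _ && _]andbC.
Qed.

End face_sums.

(** * Testing with an indicator function *)

Section indicator_test.
Context {R : realType} {d : nat} {G : geometry R d} {T : mesh G}.
Context (P : problem G) (S : discretization T).
Local Notation adj := (Defs.adj (@vtx _ _ _ T)).
Local Notation cut i K := (Defs.cut G (@vtx _ _ _ T) i K).
Local Notation cut_face i K L := (Defs.cut_face G (@vtx _ _ _ T) i K L).
Local Notation face_int i K L := (hint (dim_of d i).-1 (cut_face i K L)).
Implicit Types (i : 'I_3) (v : cell T -> P1 R d) (K L : cell T) (M : {set cell T}).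

(** Gauss' theorem for [ev (v K)] times beta, whose divergence reduces to the convection term
    because beta is divergence free. *)
Lemma convection_cut i v K : K \in Th T i ->
  hint (dim_of d i) (cut i K) (fun x => dot (beta P i x) (nab i v K x)) =
  \sum_(L in Th T i | adj K L)
    face_int i K L (fun x => nu_beta P i K L x * ev (v K) x).
Proof.
move=> KT; have [_ _ green] := mesh_green KT.
pose X x := ev (v K) x *: beta P i x.
have bs := beta_smooth P i.
have := green X (smooth_field_evM (v K) bs)
  (tangential_evM (v K) (beta_tangential P i)).
rewrite (_ : hint _ _ (divi G i X) =
    hint (dim_of d i) (cut i K) (fun x => dot (beta P i x) (nab i v K x))).
  move=> ->; rewrite [RHS]big_mkcond [LHS]big_mkcond; apply: eq_bigr => L _.
  (* Neighbors outside [Th T i] share an empty cut face and contribute nothing. *)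
  have [LT|LT] := boolP (L \in Th T i); last first.
    by rewrite cut_faceC cut_face_eq0// !hint_set0 if_same.
  by case: ifP => // _; apply: eq_hint => x _; rewrite dotZr mulrC.
apply: eq_hint => x [_ Ox].
by rewrite divi_evM// beta_div// mulr0 add0r.
Qed.

Definition indic M : cell T -> P1 R d := fun K => ((K \in M)%:R, 0).

Lemma ev_indic M K x : ev (indic M K) x = (K \in M)%:R.
Proof. by rewrite /ev /= dotC dot0r addr0. Qed.

Lemma nab_indic i M K x : nab i (indic M) K x = 0.
Proof. exact: tproj0. Qed.

Lemma Anab_indic i M K x : Anab P i (indic M) K x = 0.
Proof. by rewrite /Anab nab_indic mul0mx. Qed.

Lemma jump_indic M K L x : jump (indic M) K L x = (K \in M)%:R - (L \in M)%:R.
Proof. by rewrite /jump !ev_indic. Qed.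

Lemma avg_indic M K L x : avg S (indic M) K L x =
  theta S K L * (K \in M)%:R + theta S L K * (L \in M)%:R.
Proof. by rewrite /avg !ev_indic. Qed.

Lemma avg_flux_indic i M K L x : avg_flux P S i (indic M) K L x = 0.
Proof. by rewrite /avg_flux !Anab_indic !dot0r !mulr0 subrr. Qed.

(** The sum of the two integrands is the normal flux whose convective part uses the arithmetic mean
    of the two traces. *)
Definition face_balance i v K L : R :=
  face_int i K L (Sigma_n P S i v K L) + face_int i K L (weight_defect P S i v K L).

Lemma face_intN i K L (f : 'rV[R]_d -> R) : adj K L ->
  hbounded (dim_of d i).-1 (cut_face i K L) f ->
  face_int i K L (fun x => - f x) = - face_int i K L f.
Proof.
move=> aKL bf; rewrite -[RHS]mulN1r -(hintZ _ (hfinite_cut_face i aKL) bf).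
by apply: eq_hint => x _; rewrite mulN1r.
Qed.

Lemma hbounded_Sigma_n k i v K L (D : set 'rV[R]_d) (K0 : cell T) :
  D `<=` cut i K0 -> hbounded k D (Sigma_n P S i v K L).
Proof.
move=> DK; apply: hboundedB.
  apply: hboundedB; first exact: (hbounded_avg_flux P S k DK).
  apply: hboundedM; last exact: (hbounded_jump k DK).
  apply: hboundedD; last exact: (hbounded_lambda_b P S k DK).
  apply: hboundedM; first exact: hbounded_cst.
  exact: (hbounded_lambda_a P S k DK).
apply: hboundedM; first exact: (hbounded_nu_beta P k DK).
exact: (hbounded_avg S k DK).
Qed.

Lemma hbounded_weight_defect k i v K L (D : set 'rV[R]_d) (K0 : cell T) :
  D `<=` cut i K0 -> hbounded k D (weight_defect P S i v K L).
Proof.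
move=> DK; apply: hboundedM; last exact: (hbounded_jump k DK).
apply: hboundedM; first exact: hbounded_cst.
exact: (hbounded_nu_beta P k DK).
Qed.

Lemma face_balance_opp i v K L : adj K L ->
  face_balance i v L K = - face_balance i v K L.
Proof.
move=> aKL; have sub := @cut_face_sub _ _ _ T i K L.
rewrite /face_balance opprD -!face_intN//; last first.
- apply: hbounded_Sigma_n sub.
- apply: hbounded_weight_defect sub.
congr (_ + _); rewrite cut_faceC; apply: eq_hint => x _.
  exact: Sigma_n_opp.
exact: weight_defect_opp.
Qed.

(* The left-hand side collects everything the face shared by [K] and [L]
   contributes to [a_h i v (indic M) + b_h i v (indic M)]; the integrals with
   [ev (v K)] and [ev (v L)] come from Gauss' theorem on [K] and on [L]. *)
Lemma face_terms_indic i v M K L : adj K L ->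
  - face_int i K L (fun x => avg_flux P S i v K L x * jump (indic M) K L x)
  + face_int i K L (fun x =>
      lambda_a P S i K L x * (meshsize T)^-1 * jump v K L x * jump (indic M) K L x)
  + 2^-1 * ((K \in M)%:R * face_int i K L (fun x => nu_beta P i K L x * ev (v K) x)
          + (L \in M)%:R * face_int i L K (fun x => nu_beta P i L K x * ev (v L) x))
  + 2^-1 * (face_int i K L
              (fun x => nu_beta P i K L x * avg S v K L x * jump (indic M) K L x)
          - face_int i K L
              (fun x => nu_beta P i K L x * jump v K L x * avg S (indic M) K L x))
  + face_int i K L
      (fun x => lambda_b P S i K L x * jump v K L x * jump (indic M) K L x) =
  - (((K \in M)%:R - (L \in M)%:R) * face_balance i v K L).
Proof.
move=> aKL; have sub := @cut_face_sub _ _ _ T i K L.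
have fin := hfinite_cut_face i aKL.
set m : R := (K \in M)%:R; set l : R := (L \in M)%:R.
set k := (dim_of d i).-1.
have bflux := hbounded_avg_flux P S k sub v K L.
have bjump := hbounded_jump k sub v K L.
have bla := hbounded_lambda_a P S k sub K L.
have blb := hbounded_lambda_b P S k sub K L.
have bnb := hbounded_nu_beta P k sub K L.
have bK := hbounded_ev k (v K) sub.
have bL := hbounded_ev k (v L) sub.
have blaj := hboundedM (hboundedM bla (hbounded_cst k _ (meshsize T)^-1)) bjump.
have blbj := hboundedM blb bjump.
have bnK := hboundedM bnb bK.
have bnL := hboundedM bnb bL.
set I1 := face_int i K L (avg_flux P S i v K L).
set I2 := face_int i K L (fun x =>
  lambda_a P S i K L x * (meshsize T)^-1 * jump v K L x).
set I5 := face_int i K L (fun x => lambda_b P S i K L x * jump v K L x).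
set FK := face_int i K L (fun x => nu_beta P i K L x * ev (v K) x).
set FL := face_int i K L (fun x => nu_beta P i K L x * ev (v L) x).
have thE : theta S L K = 1 - theta S K L.
  by rewrite -(theta_sum S aKL) addrC addKr.
have Zc f c g : hbounded k (cut_face i K L) f -> (forall x, g x = c * f x) ->
    face_int i K L g = c * face_int i K L f.
  by move=> bf gE; rewrite -(hintZ c fin bf); apply: eq_hint => x _.
(* All convective face integrals are reduced to [FK] and [FL]; with [I1], [I2], [I5] this leaves an
   algebraic identity in a few real numbers. *)
have combine c c' g : (forall x, g x = c * (nu_beta P i K L x * ev (v K) x) +
      c' * (nu_beta P i K L x * ev (v L) x)) ->
    face_int i K L g = c * FK + c' * FL.
  have bcK := hboundedM (hbounded_cst k _ c) bnK.
  have bcL := hboundedM (hbounded_cst k _ c') bnL.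
  rewrite /FK /FL -(hintZ c fin bnK) -(hintZ c' fin bnL) -(hintD fin bcK bcL) => gE.
  by apply: eq_hint => x _.
rewrite (Zc (avg_flux P S i v K L) (m - l)) -/I1//; last first.
  by move=> x; rewrite jump_indic mulrC.
rewrite (Zc (fun x => lambda_a P S i K L x * (meshsize T)^-1 * jump v K L x) (m - l))
  -/I2//; last by move=> x; rewrite jump_indic mulrC.
(* Gauss' theorem on [L] uses the opposite co-normal. *)
have -> : face_int i L K (fun x => nu_beta P i L K x * ev (v L) x) = - FL.
  rewrite -face_intN// cut_faceC; apply: eq_hint => x _.
  by rewrite nu_beta_opp// mulNr.
rewrite (combine (theta S K L * (m - l)) ((1 - theta S K L) * (m - l))); last first.
  by move=> x; rewrite jump_indic /avg thE -/m -/l; ring.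
rewrite (combine (theta S K L * m + (1 - theta S K L) * l)
  (- (theta S K L * m + (1 - theta S K L) * l))); last first.
  by move=> x; rewrite avg_indic /jump thE -/m -/l; ring.
rewrite (Zc (fun x => lambda_b P S i K L x * jump v K L x) (m - l))
  -/I5//; last by move=> x; rewrite jump_indic mulrC.
rewrite /face_balance.
have -> : face_int i K L (Sigma_n P S i v K L) =
    I1 - (I2 + I5) - (theta S K L * FK + (1 - theta S K L) * FL).
  have blab := hboundedD blaj blbj.
  have bavg := hboundedM bnb (hbounded_avg S k sub v K L).
  rewrite /I1 /I2 /I5 -(hintD fin blaj blbj) -(hintB fin bflux blab).
  rewrite -(combine _ _ (fun x => nu_beta P i K L x * avg S v K L x)); last first.
    by move=> x; rewrite /avg thE; ring.
  rewrite -(hintB fin (hboundedB bflux blab) bavg).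
  by apply: eq_hint => x _; rewrite /Sigma_n; ring.
rewrite (combine (theta S K L - 2^-1) (- (theta S K L - 2^-1))); last first.
  by move=> x; rewrite /weight_defect /jump; ring.
by field.
Qed.

End indicator_test.

(** * The tested equation and the conservation laws *)

Section discrete_conservation.
Context {R : realType} {d : nat} {G : geometry R d} {T : mesh G}.
Context (P : problem G) (S : discretization T).
Local Notation adj := (Defs.adj (@vtx _ _ _ T)).
Local Notation cut i K := (Defs.cut G (@vtx _ _ _ T) i K).
Local Notation cut_face i K L := (Defs.cut_face G (@vtx _ _ _ T) i K L).
Implicit Types (i j : 'I_3) (v : cell T -> P1 R d) (K L : cell T) (M : {set cell T}).

Lemma int_el_eq0 i M (g : cell T -> 'rV[R]_d -> R) :
  (forall K x, K \in M -> cut i K x -> g K x = 0) -> int_el i M g = 0.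
Proof.
move=> g0; rewrite /int_el big1// => K KM.
rewrite (@eq_hint _ _ _ _ _ (fun=> 0)) ?hint0// => x Kx; exact: g0.
Qed.

Lemma int_faces_eq0 M (g : cell T -> cell T -> 'rV[R]_d -> R) :
  (forall K L x, K \in M -> L \in M -> g K L x = 0) -> int_faces (faces M) g = 0.
Proof.
move=> g0; rewrite /int_faces big1// => p; rewrite inE => /and4P[p1 p2 _ _].
rewrite (@eq_hint _ _ _ _ _ (fun=> 0)) ?hint0// => x _; exact: g0.
Qed.

Lemma convection_indic i v M : M \subset Th T i ->
  int_el i (Th T i) (fun K x => dot (beta P i x) (nab i v K x) * ev (indic M K) x) =
  \sum_(p in faces (Th T i))
    ((p.1 \in M)%:R * hint (dim_of d i).-1 (cut_face i p.1 p.2)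
                        (fun x => nu_beta P i p.1 p.2 x * ev (v p.1) x)
   + (p.2 \in M)%:R * hint (dim_of d i).-1 (cut_face i p.2 p.1)
                        (fun x => nu_beta P i p.2 p.1 x * ev (v p.2) x)).
Proof.
move=> MT.
rewrite -(sum_adj_faces _ (fun K L => (K \in M)%:R *
  hint (dim_of d i).-1 (cut_face i K L) (fun x => nu_beta P i K L x * ev (v K) x))).
apply: eq_bigr => K KT; rewrite -mulr_sumr -convection_cut//.
have sub : cut i K `<=` cut i K by [].
have bd := hbounded_dot (hbounded_beta P (dim_of d i) sub)
  (hbounded_nab (dim_of d i) sub v K).
rewrite -(hintZ _ (hfinite_cut i K) bd).
by apply: eq_hint => x _; rewrite ev_indic mulrC.
Qed.

Lemma ab_indic i v M : M \subset Th T i ->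
  a_h P S i v (indic M) + b_h P S i v (indic M) =
  - \sum_(p in boundary_faces i M) face_balance P S i v p.1 p.2.
Proof.
move=> MT; rewrite -sum_faces_boundary//; last exact: face_balance_opp.
rewrite -sumrN /a_h /b_h convection_indic//.
(* The diffusion volume term, the symmetry term and half of the volume convection contain the
   gradient of the indicator and vanish. *)
rewrite [X in X - _ - _ + _]int_el_eq0; last first.
  by move=> K x _ _; rewrite nab_indic dot0r.
rewrite [X in _ - _ - X + _](_ : _ = 0); last first.
  rewrite /int_cut_faces big1// => p _.
  rewrite (@eq_hint _ _ _ _ _ (fun=> 0)) ?hint0// => x _.
  by rewrite avg_flux_indic mulr0.
rewrite [X in 2^-1 * (_ - X) + _](int_el_eq0 (i := i)); last first.
  by move=> K x _ _; rewrite nab_indic dot0r mulr0.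
have adj_face p : p \in faces (Th T i) -> adj p.1 p.2.
  by rewrite [_ \in _]inE => /and4P[].
rewrite [RHS](eq_bigr _ (fun p pF => esym (face_terms_indic P S i v M (adj_face p pF)))).
rewrite !big_split/= !sumrN -!mulr_sumr !big_split/= !sumrN /int_cut_faces.
ring.
Qed.

Lemma macro_sub i M : M \in macros S i -> M \subset Th T i.
Proof.
move=> MS; have [/and3P[/eqP <- _ _] _] := macros_partition S i.
exact: (finset.bigcup_sup M MS).
Qed.

Lemma macro_separated i M M' : M \in macros S i -> M' \in macros S i ->
  forall K L, K \in M' -> L \in M' -> (K \in M) = (L \in M).
Proof.
move=> MS MS' K L KM LM.
have [/and3P[_ /finset.trivIsetP triv _] _] := macros_partition S i.
have [->|neq] := eqVneq M M'; first by rewrite KM LM.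
by have dis := triv _ _ MS MS' neq; rewrite !(disjointFl dis).
Qed.

(** The stabilization jumps only across faces inside single macro elements, where the indicator is
    constant, and its other terms involve gradients. The hypothesis covers both a macro element and
    the empty set. *)
Lemma stabilization_indic i v M :
  (forall M' K L, M' \in macros S i -> K \in M' -> L \in M' -> (K \in M) = (L \in M)) ->
  s_h S i v (indic M) = 0.
Proof.
move=> sep; rewrite /s_h big1// => M' MS.
have jump0 k : jump_prod M' k v (indic M) = 0.
  rewrite /jump_prod; apply: int_faces_eq0 => K L x KM LM.
  case: ifP => _; last by rewrite subrr dot0r.
  by rewrite jump_indic (sep _ _ _ MS KM LM) subrr mulr0.
rewrite /s_hM; case: ifP => _; last by rewrite big1// => k _; rewrite jump0 mulr0.
rewrite big1 ?add0r; last by move=> k _; rewrite jump0 mulr0.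
by rewrite int_el_eq0 ?mulr0// => K x _ _; rewrite dot0r mulr0.
Qed.

Lemma eq_int_el i M (f g : cell T -> 'rV[R]_d -> R) :
  (forall K x, f K x = g K x) -> int_el i M f = int_el i M g.
Proof. by move=> fg; apply: eq_bigr => K _; apply: eq_hint => x _. Qed.

(** Integrability, not boundedness, is assumed so that the source terms are covered too. *)
Lemma int_el_indic i M c (g : cell T -> 'rV[R]_d -> R) :
  (forall K, (hausdorff (dim_of d i)).-integrable
     (cut i K : set (caratheodory_type (@hausdorff_outer R d (dim_of d i))))
     (EFin \o g K)) ->
  int_el i (Th T i) (fun K x => (K \in M)%:R * (c * g K x)) = c * int_el i M g.
Proof.
move=> ig; rewrite /int_el mulr_sumr [LHS]big_mkcond [RHS]big_mkcond.
apply: eq_bigr => K _; case: (boolP (K \in Th T i)) => KT; last first.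
  by case: ifP => // _; rewrite cut_eq0// hint_set0 mulr0.
have mK : hmeasurable (dim_of d i) (cut i K) by exact: hmeasurable_cut.
case: (boolP (K \in M)) => KM; last first.
  by rewrite (@eq_hint _ _ _ _ _ (fun=> 0)) ?hint0// => x _; rewrite mul0r.
rewrite -(RintegralZl c mK (ig K)).
by apply: eq_hint => x _; rewrite mul1r.
Qed.

Lemma kjump_integrable j (u : 'I_3 -> cell T -> P1 R d) K :
  (hausdorff (dim_of d i0)).-integrable
     (cut i0 K : set (caratheodory_type (@hausdorff_outer R d (dim_of d i0))))
     (EFin \o kjump P j u K).
Proof.
have sub : cut i0 K `<=` cut i0 K by [].
apply: hbounded_integrable; first exact: hfinite_cut.
apply: hboundedB; apply: hboundedM.
- exact: hbounded_cst.
- exact: (hbounded_ev _ _ sub).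
- exact: hbounded_cst.
- exact: (hbounded_ev _ _ sub).
Qed.

Lemma source_cut_integrable i K :
  (hausdorff (dim_of d i)).-integrable
     (cut i K : set (caratheodory_type (@hausdorff_outer R d (dim_of d i))))
     (EFin \o source P i).
Proof.
apply: integrableS (source_integrable P i).
- exact: hmeasurable_Om.
- exact: hmeasurable_cut.
- by move=> x [].
Qed.

Lemma div_beta_int0 i v M :
  int_el i M (fun K x => divi G i (beta P i) x * ev (v K) x) = 0.
Proof. by apply: int_el_eq0 => K x _ [_ Ox]; rewrite beta_div// mul0r. Qed.

Lemma sum_face_balance i v M :
  \sum_(p in boundary_faces i M) face_balance P S i v p.1 p.2 =
  int_cut_faces i (boundary_faces i M) (Sigma_n P S i v)
  + int_cut_faces i (boundary_faces i M) (weight_defect P S i v).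
Proof. by rewrite big_split. Qed.

Definition indic_at i M : 'I_3 -> cell T -> P1 R d :=
  fun j => indic (if j == i then M else finset.set0).

Lemma in_Wh_indic_at i M : interior_macro M -> in_Wh (indic_at i M).
Proof.
move=> intM j K l bK x _; rewrite ev_indic; case: ifP => _; last by rewrite inE.
by case: (boolP (K \in M)) => // /intM /(_ bK).
Qed.

Lemma L_h_indic_at i M :
  L_h P (indic_at i M) = kappat P i * int_el i M (fun _ x => source P i x).
Proof.
rewrite /L_h (bigD1 i)//= big1 ?addr0; last first.
  move=> j /negbTE ji; apply: int_el_eq0 => K x _ _.
  by rewrite ev_indic ji inE !mulr0.
rewrite -int_el_indic; last by move=> K; exact: source_cut_integrable.
by apply: eq_int_el => K x; rewrite ev_indic eqxx; ring.
Qed.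

(** Components other than [i] are tested with the indicator of the empty set and drop out, except
    through the coupling, where [i0 == i] accounts for the surface component present in every
    jump. *)
Lemma A_h_indic_at i M u : M \in macros S i ->
  A_h P S u (indic_at i M) =
  - (kappat P i * (int_cut_faces i (boundary_faces i M) (Sigma_n P S i (u i))
    + int_cut_faces i (boundary_faces i M) (weight_defect P S i (u i))))
  + \sum_(j | j != i0) (kappa0 P j)^-1 *
      (kappa P j * (j == i)%:R - kappa0 P j * (i0 == i)%:R) * int_el i0 M (kjump P j u).
Proof.
move=> MS; rewrite /A_h; congr (_ + _).
  rewrite (bigD1 i)//= big1 ?addr0 => [|j /negbTE ji].
    rewrite /indic_at eqxx ab_indic ?macro_sub// stabilization_indic ?addr0.
      by rewrite -sum_face_balance mulrN.
    by move=> M' K L MS'; exact: (macro_separated MS MS').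
  rewrite /indic_at ji ab_indic ?finset.sub0set// stabilization_indic ?addr0.
    by rewrite big1 ?oppr0 ?mulr0// => p; rewrite !inE.
  by move=> M' K L _ _ _; rewrite !inE.
apply: eq_bigr => j _.
rewrite -int_el_indic; last by move=> K; exact: kjump_integrable.
apply: eq_int_el => K x; rewrite {2}/kjump !ev_indic.
have mem k : (K \in (if k == i then M else finset.set0))%:R =
    (k == i)%:R * (K \in M)%:R :> R.
  by case: (k == i); rewrite ?mul1r// inE mul0r.
by rewrite !mem; ring.
Qed.

Lemma kappat_neq0 i : kappat P i != 0.
Proof.
rewrite /kappat; case: (eqVneq i i0) => [_|i0']; first exact: oner_neq0.
have [k0 k0'] := kappa_gt0 P i0'.
by rewrite mulf_neq0 ?invr_eq0 ?gt_eqF.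
Qed.

End discrete_conservation.

(** The tested equation is divided by the nonzero factor [kappat P i]. The flux enters it with a
    minus sign, while the coupling is tested with [kappa] in the bulk and with minus [kappa0] on the
    surface; hence the jump appears with a minus sign in the bulk law and a plus sign in the surface
    law. The weight defect is kept because [theta] is arbitrary. *)
Theorem mainTheorem2 (R : realType) (d : nat) (G : geometry R d) (T : mesh G)
    (P : problem G) (S : discretization T)
    (u : 'I_3 -> cell T -> P1 R d) (hu : in_Wh u)
    (sol : forall v, in_Wh v -> A_h P S u v = L_h P v) :
  (forall (i : 'I_3) (M : {set cell T}), i != i0 -> M \in macros S i ->
     interior_macro M ->
     int_cut_faces i (boundary_faces i M) (Sigma_n P S i (u i))
     + int_cut_faces i (boundary_faces i M) (weight_defect P S i (u i))
     - int_el i0 M (kjump P i u)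
     + 2^-1 * int_el i M (fun K x => divi G i (beta P i) x * ev (u i K) x)
     + int_el i M (fun _ x => source P i x) = 0)
  /\
  (forall M : {set cell T}, M \in macros S i0 -> interior_macro M ->
     int_cut_faces i0 (boundary_faces i0 M) (Sigma_n P S i0 (u i0))
     + int_cut_faces i0 (boundary_faces i0 M) (weight_defect P S i0 (u i0))
     + \sum_(i | i != i0) int_el i0 M (kjump P i u)
     + 2^-1 * int_el i0 M (fun K x => divi G i0 (beta P i0) x * ev (u i0 K) x)
     + int_el i0 M (fun _ x => source P i0 x) = 0).
Proof.
split=> [i M ni0 MS intM|M MS intM]; rewrite div_beta_int0 mulr0 addr0.
  have := sol _ (in_Wh_indic_at i intM).
  rewrite A_h_indic_at// L_h_indic_at (bigD1 i)//= big1 ?addr0; last first.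
    move=> j /andP[_ /negbTE ->].
    by rewrite [i0 == i]eq_sym (negbTE ni0) !mulr0 subrr mulr0 mul0r.
  rewrite eqxx [i0 == i]eq_sym (negbTE ni0) mulr0 subr0 mulr1 [_^-1 * _]mulrC.
  (* The coupling carries the same factor as the flux and the source, so it cancels throughout. *)
  have -> : kappa P i / kappa0 P i = kappat P i by rewrite /kappat (negbTE ni0).
  move=> E; apply: (mulfI (kappat_neq0 P i)); rewrite mulr0.
  by rewrite mulrDr -E; ring.
have := sol _ (in_Wh_indic_at i0 intM).
rewrite A_h_indic_at// L_h_indic_at.
(* On the surface the test function contributes minus [kappa0] to each jump, which cancels against
   the weight of the coupling. *)
rewrite (eq_bigr (fun j => - int_el i0 M (kjump P j u))); last first.
  move=> j nj; have [_ k0] := kappa_gt0 P nj.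
  by rewrite eqxx (negbTE nj) mulr0 sub0r mulr1 mulrN mulVf ?gt_eqF// mulN1r.
rewrite sumrN /kappat eqxx !mul1r => <-; ring.
Qed.
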